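(* Let $G$ be a group acting on a compactly generated Hausdorff path-connected space $X$ with basepoint $x_0$. Let $W$ be a space and let $\Gamma=(\Gamma,\gamma_1,\gamma_2;\nu,\eta)$ be a co-grouplike space with two distinct basepoints. Let $G_0$ be the subgroup of $G$ consisting of the elements $g$ which, considered as homeomorphisms of $X$, are freely homotopic to the identity map $\mathrm{id}_X$. Then the sequence of groups $$1\to\mathcal G\tau^{\Gamma_0}_W(X,x_0)\to\mathcal G\sigma^\Gamma_W(X,x_0,G)\to G_0\to1$$ is exact, where the second map is $[f;g]\mapsto g$ and the first is the restriction of the canonical inclusion $\tau^{\Gamma_0}_W(X,x_0)\to\sigma^\Gamma_W(X,x_0,G)$.
   Context: $G$ acts on $X$ by homeomorphisms. **Co-grouplike space with two basepoints.** This is a space $\Gamma$ with points $\gamma_1\ne\gamma_2$ and maps $\nu,\eta$ as follows. Put $D=\Gamma\times\{\gamma_1\}\cup\{\gamma_2\}\times\Gamma$. (I) $\nu:(\Gamma,\gamma_1,\gamma_2)\to(D,(\gamma_1,\gamma_1),(\gamma_2,\gamma_2))$ is a map such that, for $i=1,2$, $\mathrm{proj}_i\circ\nu\simeq\mathrm{id}$ as maps of triples $(\Gamma,\gamma_1,\gamma_2)\to(\Gamma,\gamma_1,\gamma_2)$, where $\mathrm{proj}_1,\mathrm{proj}_2:D\to\Gamma$ are the coordinate projections. (II) $\eta:\Gamma\to\Gamma$ is a map such that: - (a) $\eta(\gamma_1)=\gamma_2$ and $\eta(\gamma_2)=\gamma_1$. - (b) Let $h:D\to\Gamma$ be given by $h(\gamma,\gamma_1)=\gamma$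 and $h(\gamma_2,\gamma)=\eta(\gamma)$. Then $h\circ\nu$, which sends both basepoints to $\gamma_1$, is homotopic to the constant map at $\gamma_1$. - (c) Let $h':D\to\Gamma$ be given by $h'(\gamma,\gamma_1)=\eta(\gamma)$ and $h'(\gamma_2,\gamma)=\gamma$. Then $h'\circ\nu$, which sends both basepoints to $\gamma_2$, is homotopic to the constant map at $\gamma_2$. The homotopies in (b) and (c) keep the images of $\gamma_1,\gamma_2$ fixed. (III) (Co-associativity) Let $T=\{(\gamma,\gamma_1,\gamma_1)\}\cup\{(\gamma_2,\gamma,\gamma_1)\}\cup\{(\gamma_2,\gamma_2,\gamma)\}\subset\Gamma^3$ ($\gamma\in\Gamma$), with basepoints $(\gamma_1,\gamma_1,\gamma_1)$ and $(\gamma_2,\gamma_2,\gamma_2)$. The two maps $\Gamma\to T$ obtained from $\nu$ followed respectively by - $(\gamma,\gamma_1)\mapsto(\gamma,\gamma_1,\gamma_1)$, $(\gamma_2,\gamma)\mapsto(\gamma_2,\nu(\gamma))$, and - $(\gamma,\gamma_1)\mapsto(\nu(\gamma),\gamma_1)$, $(\gamma_2,\gamma)\mapsto(\gamma_2,\gamma_2,\gamma)$ are homotopic (as maps preserving the two basepoints). **Associated objects.** $\Gamma_0$ is $\Gamma$ with $\gamma_1$ and $\gamma_2$ identified; the common image is its basepoint, and it is a co-grouplike space in the usual sense, with comultiplication induced by $\nu$. For a space $W$, $\Gamma(W)=(W\times\Gamma)/\big((w,\gamma_1)\sim(w',\gamma_1),\ (w,\gamma_2)\sim(w',\gamma_2)\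 \forall w,w'\in W\big)$. Its basepoints $\bar\gamma_1,\bar\gamma_2$ are the classes of $(w,\gamma_1)$ and $(w,\gamma_2)$. Identifying $\bar\gamma_1$ with $\bar\gamma_2$ gives $\Gamma_0\wedge(W\sqcup\{*\})$, where $W\sqcup\{*\}$ is $W$ with a disjoint basepoint. **Groups.** For a $G$-space $Y$ with basepoint $y_0$, $\sigma^\Gamma_W(Y,y_0,G)=\{[f;g]: g\in G,\ f:(\Gamma(W),\bar\gamma_1,\bar\gamma_2)\to(Y,y_0,gy_0)\}$ is the $W$-$\Gamma$-Rhodes group, where $[f;g]$ is the homotopy class of $f$ through maps of triples $(\Gamma(W),\bar\gamma_1,\bar\gamma_2)\to(Y,y_0,gy_0)$. The operation is $[f_1;g_1]*[f_2;g_2]=[f_1+g_1f_2;g_1g_2]$. Here $(f_1+g_1f_2)(w,\gamma)=f_1(w,\gamma')$ if $\nu(\gamma)=(\gamma',\gamma_1)$, and $(f_1+g_1f_2)(w,\gamma)=g_1\cdot f_2(w,\gamma'')$ if $\nu(\gamma)=(\gamma_2,\gamma'')$. $\tau^{\Gamma_0}_W(Y,y_0)=[\Gamma_0\wedge(W\sqcup\{*\}),Y]$ is the $\Gamma_0$-$W$-Fox group (pointed homotopy classes, with group structure from the co-grouplike structure of $\Gamma_0$). The canonical inclusion $\tau^{\Gamma_0}_W(Y,y_0)\to\sigma^\Gamma_W(Y,y_0,G)$ sends $[\phi]$ to $[\phi\circ q;1]$, with $q:\Gamma(W)\to\Gamma_0\wedge(W\sqcup\{*\})$ the quotient map. **Evaluation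 subgroups.** The function space $X^X$ of continuous self-maps of $X$ has basepoint $\mathrm{id}_X$ and $G$-action $(gf)(x)=gf(x)$. The evaluation map $ev:X^X\to X$, $ev(f)=f(x_0)$, is $G$-equivariant and pointed, and induces homomorphisms $ev_*$. Define $$\mathcal G\sigma^\Gamma_W(X,x_0,G)=\operatorname{Im}\big(ev_*:\sigma^\Gamma_W(X^X,\mathrm{id}_X,G)\to\sigma^\Gamma_W(X,x_0,G)\big),$$ $$\mathcal G\tau^{\Gamma_0}_W(X,x_0)=\operatorname{Im}\big(ev_*:\tau^{\Gamma_0}_W(X^X,\mathrm{id}_X)\to\tau^{\Gamma_0}_W(X,x_0)\big).$$
   Formalization: Added: W is nonempty, γ1 and γ2 are closed points of Γ, and a path in Γ joins γ1 to γ2; without the path it fails, e.g. Γ two discrete points, W a point, X the circle, G=Z/2 acting by a reflection. *)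

(* Defs.v *)
From HB Require Import structures.
From mathcomp Require Import all_boot all_order all_algebra.
From mathcomp Require Import all_classical all_reals.
From mathcomp Require Import topology normedtype.

Set Implicit Arguments.
Unset Strict Implicit.
Unset Printing Implicit Defensive.

Import Order.TTheory GRing.Theory Num.Theory.
Import numFieldNormedType.Exports.

Local Open Scope classical_set_scope.
Local Open Scope ring_scope.
Local Open Scope quotient_scope.

Definition compactly_generated (X : topologicalType) : Prop :=
  forall A : set X,
    (forall K : set X, compact K -> closed (A `&` K)) -> closed A.

Definition path_joined (R : realType) (X : topologicalType) (x y : X) : Prop :=
  exists p : R -> X,
    [/\ {within `[0, 1], continuous p}, p 0 = x & p 1 = y].

(* [f] and [g] are homotopic through maps satisfying [P]; the parameter runs
   over the unit interval of [R].  Taking for [P] a condition on basepoints gives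
   homotopies of pointed maps or of maps of triples. *)
Definition homotopic_through (R : realType) (A B : topologicalType)
    (P : (A -> B) -> Prop) (f g : A -> B) : Prop :=
  exists H : A * R -> B,
    [/\ {within [set: A] `*` `[0, 1], continuous H},
        forall x, H (x, 0) = f x,
        forall x, H (x, 1) = g x
      & forall t, 0 <= t <= 1 -> P (fun x => H (x, t))].

Section continuity_facts.

Lemma cts_comp (A B C : topologicalType) (f : A -> B) (g : B -> C) :
  continuous f -> continuous g -> continuous (fun x => g (f x)).
Proof. by move=> cf cg x; apply: continuous_comp; [exact: cf|exact: cg]. Qed.

Lemma cts_pair (A B C : topologicalType) (f : A -> B) (g : A -> C) :
  continuous f -> continuous g -> continuous (fun x => (f x, g x)).
Proof. by move=> cf cg x; apply: cvg_pair => /=; [exact: cf|exact: cg]. Qed.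

Lemma cts_fst (A B : topologicalType) : continuous (@fst A B).
Proof. by move=> x; exact: cvg_fst. Qed.

Lemma cts_snd (A B : topologicalType) : continuous (@snd A B).
Proof. by move=> x; exact: cvg_snd. Qed.

Lemma cts_o (A B C : topologicalType) (g : B -> C) (f : A -> B) :
  continuous g -> continuous f -> continuous (fun x => g (f x)).
Proof. by move=> cg cf; exact: cts_comp cf cg. Qed.

Lemma cts_fst_fst (A B C : topologicalType) :
  continuous (fun v : A * B * C => v.1.1).
Proof. exact: cts_comp (@cts_fst _ _) (@cts_fst _ _). Qed.

Lemma cts_fst_snd (A B C : topologicalType) :
  continuous (fun v : A * B * C => v.1.2).
Proof. exact: cts_comp (@cts_fst _ _) (@cts_snd _ _). Qed.

Lemma closed_preim (A B : topologicalType) (f : A -> B) (D : set B) :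
  continuous f -> closed D -> closed (f @^-1` D).
Proof. by move=> cf; apply: preimage_closed => x _; exact: cf. Qed.

Lemma closed_glue (A B : topologicalType) (S1 S2 : set A) (f f1 f2 : A -> B) :
  closed S1 -> closed S2 -> (forall x, S1 x \/ S2 x) ->
  continuous f1 -> continuous f2 ->
  (forall x, S1 x -> f x = f1 x) -> (forall x, S2 x -> f x = f2 x) ->
  continuous f.
Proof.
move=> cl1 cl2 S12 c1 c2 e1 e2; apply/continuous_closedP => D cD.
have -> : f @^-1` D = (S1 `&` f1 @^-1` D) `|` (S2 `&` f2 @^-1` D).
  apply/seteqP; split=> x /=.
    by case: (S12 x) => Sx; [rewrite e1//; left|rewrite e2//; right].
  by case=> -[Sx]; [rewrite e1|rewrite e2].
by apply: closedU; apply: closedI => //; exact: closed_preim.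
Qed.

End continuity_facts.

Section homotopy_facts.
Context {R : realType} {A B : topologicalType}.
Implicit Types (P : (A -> B) -> Prop) (f g h : A -> B).

Let clamp (t : R) : R := Num.max 0 (Num.min t 1).

Let clamp_itv t : 0 <= clamp t <= 1.
Proof.
rewrite /clamp le_max lexx/= ge_max ler01/=.
by rewrite ge_min lexx orbT.
Qed.

Let clamp_continuous : continuous clamp.
Proof.
have cmin : continuous (fun t : R => Num.min t 1).
  by move=> t; apply: (@continuous_min R R id (cst 1)); exact: cvg_cst || exact: cvg_id.
by move=> t; apply: (@continuous_max R R (cst 0) (fun t => Num.min t 1));
  [exact: cvg_cst|exact: cmin].
Qed.

Let clamp_le0 t : t <= 0 -> clamp t = 0.
Proof. by move=> t0; apply/max_idPl; rewrite ge_min t0. Qed.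

Let clamp_ge1 t : 1 <= t -> clamp t = 1.
Proof. by move=> t1; rewrite /clamp (min_idPr t1); apply/max_idPr. Qed.

Lemma homotopic_throughP P f g :
  homotopic_through R P f g <->
  exists H : A * R -> B,
    [/\ continuous H, forall x t, t <= 0 -> H (x, t) = f x,
        forall x t, 1 <= t -> H (x, t) = g x
      & forall t, P (fun x => H (x, t))].
Proof.
split=> [[H [cH H0 H1 HP]]|[H [cH H0 H1 HP]]].
  exists (fun p => H (p.1, clamp p.2)); split=> [|x t t0|x t t1|t].
  - pose k := fun p : A * R => (p.1, clamp p.2).
    have kin p : ([set: A] `*` `[0, 1]) (k p).
      by split => //=; rewrite in_itv/= clamp_itv.
    have ck : continuous k.
      by apply: cts_pair; [exact: cts_fst|exact: cts_comp (@cts_snd _ _) _].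
    move/continuousP : cH => cH; apply/continuousP => U oU.
    have [V oV VE] := (open_subspaceP _ _).1 (cH U oU).
    rewrite (_ : _ @^-1` U = k @^-1` V); first by apply: open_comp => // *; exact: ck.
    apply/seteqP; split=> p /=.
      move=> Hp; have : (H @^-1` U `&` ([set: A] `*` `[0, 1])) (k p) by [].
      by rewrite -VE => -[].
    move=> Vp; have : (V `&` ([set: A] `*` `[0, 1])) (k p) by [].
    by rewrite VE => -[].
  - by rewrite /= clamp_le0.
  - by rewrite /= clamp_ge1.
  - exact: (HP _ (clamp_itv t)).
exists H; split=> // [|x|x]; first exact: continuous_subspaceT.
  exact: H0.
exact: H1.
Qed.

Lemma homotopic_refl P f g : continuous f -> P f -> f =1 g ->
  homotopic_through R P f g.
Proof.
move=> cf Pf fg; apply/homotopic_throughP; exists (f \o fst); split=> //.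
  exact: cts_comp (@cts_fst _ _) cf.
by move=> x t _; exact: fg.
Qed.

Lemma homotopic_sym P f g :
  homotopic_through R P f g -> homotopic_through R P g f.
Proof.
move=> /homotopic_throughP[H [cH H0 H1 HP]]; apply/homotopic_throughP.
exists (fun p => H (p.1, 1 - p.2)); split=> [|x t t0|x t t1|t].
- apply: cts_comp cH; apply: cts_pair; first exact: cts_fst.
  by move=> p; apply: cvgB; [exact: cvg_cst|exact: cvg_snd].
- by rewrite H1//= lerBrDr gerDl.
- by rewrite H0//= subr_le0.
- exact: (HP (1 - t)).
Qed.

Lemma homotopic_trans P f g h :
  homotopic_through R P f g -> homotopic_through R P g h ->
  homotopic_through R P f h.
Proof.
move=> /homotopic_throughP[H [cH H0 H1 HP]].
move=> /homotopic_throughP[K [cK K0 K1 KP]]; apply/homotopic_throughP.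
pose L := fun p : A * R => if p.2 <= 1 then H p else K (p.1, p.2 - 1).
have cL : continuous L.
  refine (@closed_glue (A * R)%type B [set p | p.2 <= 1] [set p | 1 <= p.2]
      L H (fun p => K (p.1, p.2 - 1)) _ _ _ _ _ _ _) => //.
  - exact: (closed_preim (@cts_snd A R) (@closed_le R 1)).
  - exact: (closed_preim (@cts_snd A R) (@closed_ge R 1)).
  - by move=> p /=; case: (lerP p.2 1) => [|/ltW]; [left|right].
  - apply: cts_comp cK; apply: cts_pair; first exact: cts_fst.
    by move=> p; apply: cvgB; [exact: cvg_snd|exact: cvg_cst].
  - by move=> p /= p1; rewrite /L p1.
  - move=> [x t] /= t1; rewrite /L /=; case: ifPn => // t1'.
    by rewrite H1// K0// subr_le0.
exists (fun p => L (p.1, p.2 * 2)); split=> [|x t t0|x t t1|t].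
- apply: cts_comp cL; apply: cts_pair; first exact: cts_fst.
  by move=> p; apply: cvgM; [exact: cvg_snd|exact: cvg_cst].
- have t20 : t * 2 <= 0 by rewrite mulr_le0_ge0.
  by rewrite /L/= (le_trans t20 ler01) H0.
- have t2 : 2 <= t * 2 by rewrite -[leLHS]mul1r ler_wpM2r.
  have t21 : 1 < t * 2 by rewrite (lt_le_trans _ t2)// ltr1n.
  by rewrite /L/= leNgt t21/= K1// lerBrDr (le_trans _ t2).
- rewrite /L/=; case: (t * 2 <= 1); first exact: (HP (t * 2)).
  exact: (KP (t * 2 - 1)).
Qed.

End homotopy_facts.

Section quotient_facts.
Context {R : realType} {T : topologicalType} {Q0 : quotType T}.
Local Notation Q := (quotient_topology Q0).
Import ArrowAsCompactOpen.

Lemma quotient_prodR_continuous (Z : topologicalType) (f : Q * R -> Z) :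
  continuous (fun p : T * R => f (\pi_Q p.1, p.2)) -> continuous f.
Proof.
move=> cf; have [c1 c2] := continuous_curry cf.
have -> : f = uncurry (curry f) by apply/funext => -[].
apply: continuous_uncurry.
- exact: locally_compactR.
- exact: Rhausdorff.
- exact/(@quotient_continuous _ _ _ (curry f)).
- by move=> u; rewrite -[u]reprK; exact: (c2 (repr u)).
Qed.

End quotient_facts.

Section collapse.
Context {T : topologicalType} (A : set T).

Let collapse_rel' (x y : T) : bool := `[< x = y \/ (A x /\ A y) >].

Let collapse_refl : reflexive collapse_rel'.
Proof. by move=> x; apply/asboolP; left. Qed.

Let collapse_sym : symmetric collapse_rel'.
Proof.
by move=> x y; apply/idP/idP => /asboolP[->|[? ?]]; apply/asboolP; by [left|right].
Qed.

Let collapse_trans : transitive collapse_rel'.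
Proof.
move=> y x z /asboolP + /asboolP + ; move=> [->|[Ax Ay]] [<-|[Ay' Az]];
  by apply/asboolP; by [left|right].
Qed.

Definition collapse_rel :=
  EquivRel collapse_rel' collapse_refl collapse_sym collapse_trans.

Lemma collapse_relP x y : reflect (x = y \/ (A x /\ A y)) (collapse_rel x y).
Proof. exact: asboolP. Qed.

Definition collapse : Type := {eq_quot collapse_rel}.

HB.instance Definition _ := Quotient.on collapse.
HB.instance Definition _ :=
  Topological.copy collapse (quotient_topology {eq_quot collapse_rel}).

Definition to_collapse (x : T) : collapse := \pi_collapse x.

Lemma to_collapseP x y :
  to_collapse x = to_collapse y <-> x = y \/ (A x /\ A y).
Proof.
split=> [/eqmodP/collapse_relP//|H]; exact/eqmodP/collapse_relP.
Qed.

End collapse.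

(* W with a disjoint (hence isolated) basepoint [None]. *)
Definition adjoin_point (W : Type) : Type := option W.

Section adjoin_point.
Context (W : topologicalType).

HB.instance Definition _ := Choice.on (adjoin_point W).

Let open_ap (U : set (adjoin_point W)) : Prop := open (Some @^-1` U).

Let open_apT : open_ap setT.
Proof. exact: openT. Qed.

Let open_apI : setI_closed open_ap.
Proof. by move=> U V; exact: openI. Qed.

Let open_ap_bigU (I : Type) (f : I -> set (adjoin_point W)) :
  (forall i, open_ap (f i)) -> open_ap (\bigcup_i f i).
Proof. by move=> fo; rewrite /open_ap preimage_bigcup; apply: bigcup_open => i _; exact: fo. Qed.

HB.instance Definition _ :=
  isOpenTopological.Build (adjoin_point W) open_apT open_apI open_ap_bigU.

End adjoin_point.

Definition smash (X Y : topologicalType) (x0 : X) (y0 : Y) : Type :=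
  @collapse (X * Y)%type ([set: X] `*` [set y0] `|` [set x0] `*` [set: Y]).
HB.instance Definition _ X Y x0 y0 := Topological.on (@smash X Y x0 y0).
HB.instance Definition _ X Y x0 y0 := Quotient.on (@smash X Y x0 y0).

Section cogrouplike.
Context (Gam : bpTopologicalType).

(* D = Gamma x {gamma_1} U {gamma_2} x Gamma, with gamma_1 = [zero] and
   gamma_2 = [one].  D and T carry the subspace topology, so that maps into them
   are maps into the product with values in the subset. *)
Definition wings : set (Gam * Gam) :=
  [set: Gam] `*` [set zero] `|` [set one] `*` [set: Gam].

Definition wings3 : set (Gam * Gam * Gam) :=
  [set (g, zero, zero) | g in [set: Gam]]
    `|` [set (one, g, zero) | g in [set: Gam]]
    `|` [set (one, one, g) | g in [set: Gam]].

(* The function on D given by (g, zero) |-> a g and (one, g) |-> b g; the two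
   clauses overlap at (one, zero), where all uses below have a one = b zero. *)
Definition on_wings (Y : Type) (a b : Gam -> Y) (p : Gam * Gam) : Y :=
  if p.2 == zero then a p.1 else b p.2.

Record cogrouplike (R : realType) := Cogrouplike {
  conu : Gam -> Gam * Gam;
  coeta : Gam -> Gam;
  (* Automatic for Hausdorff Gamma: D is then the wedge of two copies of Gamma,
     and functions defined piecewise on the two copies are continuous. *)
  closed_zero : closed [set zero : Gam];
  closed_one : closed [set one : Gam];
  conu_cts : continuous conu;
  conu_wings : forall g, wings (conu g);
  conu_zero : conu zero = (zero, zero);
  conu_one : conu one = (one, one);
  conu_fst : homotopic_through R
    (fun h : Gam -> Gam => h zero = zero /\ h one = one)
    (fst \o conu) id;
  conu_snd : homotopic_through R
    (fun h : Gam -> Gam => h zero = zero /\ h one = one)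
    (snd \o conu) id;
  coeta_cts : continuous coeta;
  coeta_zero : coeta zero = one;
  coeta_one : coeta one = zero;
  coinvr : homotopic_through R
    (fun h : Gam -> Gam => h zero = zero /\ h one = zero)
    (on_wings id coeta \o conu) (cst zero);
  coinvl : homotopic_through R
    (fun h : Gam -> Gam => h zero = one /\ h one = one)
    (on_wings coeta id \o conu) (cst one);
  coassoc : homotopic_through R
    (fun h : Gam -> Gam * Gam * Gam =>
       [/\ forall g, wings3 (h g),
           h zero = (zero, zero, zero) & h one = (one, one, one)])
    (on_wings (fun g => (g, zero, zero))
       (fun g => (one, (conu g).1, (conu g).2)) \o conu)
    (on_wings (fun g => ((conu g).1, (conu g).2, zero))
       (fun g => (one, one, g)) \o conu)
}.

#[global] Arguments conu_cts {R} c.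
#[global] Arguments coeta_cts {R} c.
#[global] Arguments conu_wings {R} c.
#[global] Arguments closed_zero {R} c.
#[global] Arguments closed_one {R} c.

Definition Gam0 : Type := collapse [set zero; one : Gam].
HB.instance Definition _ := Topological.on Gam0.
HB.instance Definition _ := Quotient.on Gam0.

Definition to_Gam0 (g : Gam) : Gam0 := \pi_Gam0 g.

End cogrouplike.

(* Gamma(W).  Its basepoints are the classes of (w, zero) and of (w, one), for
   any w; conditions at the basepoints are therefore quantified over w. *)
Section GamW.
Context (Gam : bpTopologicalType) (W : topologicalType).

Let GamW_rel' (p q : W * Gam) : bool :=
  `[< [\/ p = q, p.2 = zero /\ q.2 = zero | p.2 = one /\ q.2 = one] >].

Let GamW_refl : reflexive GamW_rel'.
Proof. by move=> p; apply/asboolP; apply: Or31. Qed.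

Let GamW_sym : symmetric GamW_rel'.
Proof.
move=> p q; apply/idP/idP => /asboolP[->|[? ?]|[? ?]]; apply/asboolP;
  by [apply: Or31|apply: Or32|apply: Or33].
Qed.

Let GamW_trans : transitive GamW_rel'.
Proof.
have zo : zero <> one :> Gam by apply/eqP; exact: zero_one_neq.
move=> q p r /asboolP + /asboolP +; case=> [->|[p0 q0]|[p1 q1]];
  case=> [<-|[q0' r0]|[q1' r1]]; apply/asboolP;
  by [apply: Or31|apply: Or32|apply: Or33|move: q0'; rewrite q1 => /esym|move: q0; rewrite q1'=> /esym].
Qed.

Definition GamW_rel := EquivRel GamW_rel' GamW_refl GamW_sym GamW_trans.

Lemma GamW_relP p q :
  reflect [\/ p = q, p.2 = zero /\ q.2 = zero | p.2 = one /\ q.2 = one]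
    (GamW_rel p q).
Proof. exact: asboolP. Qed.

Definition GamW : Type := {eq_quot GamW_rel}.

HB.instance Definition _ := Quotient.on GamW.
HB.instance Definition _ :=
  Topological.copy GamW (quotient_topology {eq_quot GamW_rel}).

Definition to_GamW (p : W * Gam) : GamW := \pi_GamW p.

(* Gamma_0 /\ (W + point), and below the quotient map q from Gamma(W) to it. *)
Definition GamSmash : Type :=
  @smash (Gam0 Gam) (adjoin_point W) (to_Gam0 zero) None.
HB.instance Definition _ := Topological.on GamSmash.
HB.instance Definition _ := Quotient.on GamSmash.

Definition to_GamSmash (p : Gam0 Gam * adjoin_point W) : GamSmash :=
  \pi_GamSmash p.

Definition GamW_quot (z : GamW) : GamSmash :=
  to_GamSmash (to_Gam0 (repr z).2, Some (repr z).1).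

End GamW.
Arguments to_GamW {Gam W}.
Arguments to_GamSmash {Gam W}.

Section GamW_facts.
Context {Gam : bpTopologicalType} {W : topologicalType} {Y : topologicalType}.
Implicit Types (f : GamW Gam W -> Y) (y : Y).

(* The basepoint conditions of a map (Gamma(W), zero, one) -> (Y, y1, y2);
   continuity is stated separately. *)
Definition triple_map y1 y2 f : Prop :=
  (forall w, f (to_GamW (w, zero)) = y1) /\
  (forall w, f (to_GamW (w, one)) = y2).

Lemma to_GamW_continuous : continuous (@to_GamW Gam W).
Proof. exact: pi_continuous. Qed.

Lemma to_GamWP (p q : W * Gam) : to_GamW p = to_GamW q <->
  [\/ p = q, p.2 = zero /\ q.2 = zero | p.2 = one /\ q.2 = one].
Proof. by split=> [/eqmodP/GamW_relP//|H]; exact/eqmodP/GamW_relP. Qed.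

Lemma repr_to_GamW (B : Type) (F : W * Gam -> B) (b1 b2 : B) :
  (forall w, F (w, zero) = b1) -> (forall w, F (w, one) = b2) ->
  forall p, F (repr (to_GamW p)) = F p.
Proof.
move=> F0 F1 p; have /to_GamWP : to_GamW (repr (to_GamW p)) = to_GamW p.
  exact: reprK.
case: (repr _) => w g; case: p => w' g'.
by case=> /= [->//|[-> ->]|[-> ->]]; rewrite ?F0 ?F1.
Qed.

Lemma GamW_ind (P : GamW Gam W -> Prop) :
  (forall w g, P (to_GamW (w, g))) -> forall z, P z.
Proof. by move=> HP z; rewrite -[z]reprK; case: (repr z). Qed.

Lemma GamW_continuous f : continuous (f \o to_GamW) -> continuous f.
Proof. by move/(@quotient_continuous _ _ _ f). Qed.

Lemma GamW_htpy (R : realType) y1 y2 f f' (K : W * Gam * R -> Y) :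
  continuous K ->
  (forall w g, K (w, g, 0) = f (to_GamW (w, g))) ->
  (forall w g, K (w, g, 1) = f' (to_GamW (w, g))) ->
  (forall w t, K (w, zero, t) = y1) -> (forall w t, K (w, one, t) = y2) ->
  homotopic_through R (triple_map y1 y2) f f'.
Proof.
move=> cK K0 K1 Kz Ko.
have KE t p : K (repr (to_GamW p), t) = K (p, t).
  exact: (@repr_to_GamW _ (fun q => K (q, t)) y1 y2).
exists (fun p => K (repr p.1, p.2)); split=> [||z|t _].
- apply: continuous_subspaceT.
  apply: quotient_prodR_continuous => /=.
  rewrite (_ : (fun _ => _) = K)//; apply/funext => -[p t] /=; exact: KE.
- by elim/GamW_ind => w g; rewrite KE K0.
- by elim/GamW_ind : z => w g; rewrite KE K1.
- by split=> w; rewrite KE.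
Qed.

End GamW_facts.

Section GamW_sum.
Context {R : realType} {Gam : bpTopologicalType} (C : cogrouplike Gam R).
Context {W : topologicalType}.

(* f1 + f2 for f1 from y1 to y2 and f2 from y2 to y3. *)
Definition GamW_add (Y : Type) (f1 f2 : GamW Gam W -> Y) (z : GamW Gam W) : Y :=
  let: (w, g) := repr z in
  on_wings (fun g' => f1 (to_GamW (w, g'))) (fun g' => f2 (to_GamW (w, g')))
    (conu C g).

Definition GamW_rev (Y : Type) (f : GamW Gam W -> Y) (z : GamW Gam W) : Y :=
  let: (w, g) := repr z in f (to_GamW (w, coeta C g)).

Lemma wings_glue (V Y : topologicalType) (p : V -> Gam * Gam) (a b : V -> Y) :
  continuous p -> (forall v, (p v).2 = zero \/ (p v).1 = one) ->
  continuous a -> continuous b -> (forall v, p v = (one, zero) -> a v = b v) ->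
  continuous (fun v => if (p v).2 == zero then a v else b v).
Proof.
move=> cp pw ca cb ab.
have cl2 : closed [set v | (p v).2 = zero].
  exact: (closed_preim (cts_comp cp (@cts_snd _ _)) (closed_zero C)).
have cl1 : closed [set v | (p v).1 = one].
  exact: (closed_preim (cts_comp cp (@cts_fst _ _)) (closed_one C)).
refine (@closed_glue _ _ _ _ _ a b cl2 cl1 _ _ _ _ _) => // v /=.
  by move=> ->; rewrite eqxx.
move=> p1; case: eqP => // p2; apply: ab; rewrite -p1 -p2.
by case: (p v).
Qed.

Lemma conu_wingsP g : (conu C g).2 = zero \/ (conu C g).1 = one.
Proof. by case: (conu_wings C g) => -[]; [left|right]. Qed.

Lemma one_neq_zero : (one == zero :> Gam) = false.
Proof. by rewrite eq_sym; apply/negbTE; exact: zero_one_neq. Qed.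

Section sum.
Context {Y : topologicalType}.
Implicit Types (f : GamW Gam W -> Y) (y : Y).

Lemma GamW_addE y1 y2 y3 f1 f2 : triple_map y1 y2 f1 -> triple_map y2 y3 f2 ->
  forall w g, GamW_add f1 f2 (to_GamW (w, g)) =
  if (conu C g).2 == zero then f1 (to_GamW (w, (conu C g).1))
  else f2 (to_GamW (w, (conu C g).2)).
Proof.
move=> [f10 f11] [f20 f21] w g.
pose F (p : W * Gam) := let: (w, g) := p in
  on_wings (fun g' => f1 (to_GamW (w, g'))) (fun g' => f2 (to_GamW (w, g')))
    (conu C g).
rewrite /GamW_add -/(F _) (@repr_to_GamW _ _ _ _ y1 y3)// => w' /=.
  by rewrite conu_zero /on_wings/= eqxx f10.
by rewrite conu_one /on_wings/= one_neq_zero f21.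
Qed.

Lemma GamW_add_triple y1 y2 y3 f1 f2 :
  triple_map y1 y2 f1 -> triple_map y2 y3 f2 ->
  triple_map y1 y3 (GamW_add f1 f2).
Proof.
move=> t1 t2; split=> w; rewrite (GamW_addE t1 t2) ?conu_zero ?conu_one/=.
  by rewrite eqxx t1.1.
by rewrite one_neq_zero t2.2.
Qed.

Lemma GamW_add_homotopic y1 y2 y3 f1 f1' f2 f2' :
  homotopic_through R (triple_map y1 y2) f1 f1' ->
  homotopic_through R (triple_map y2 y3) f2 f2' ->
  homotopic_through R (triple_map y1 y3) (GamW_add f1 f2) (GamW_add f1' f2').
Proof.
move=> /homotopic_throughP[H1 [cH1 H10 H11 H1P]].
move=> /homotopic_throughP[H2 [cH2 H20 H21 H2P]].
have e10 : (fun z => H1 (z, 0)) = f1 by apply/funext => z; exact: H10.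
have e11 : (fun z => H1 (z, 1)) = f1' by apply/funext => z; exact: H11.
have e20 : (fun z => H2 (z, 0)) = f2 by apply/funext => z; exact: H20.
have e21 : (fun z => H2 (z, 1)) = f2' by apply/funext => z; exact: H21.
pose q (v : W * Gam * R) := conu C v.1.2.
pose K (v : W * Gam * R) := if (q v).2 == zero
  then H1 (to_GamW (v.1.1, (q v).1), v.2)
  else H2 (to_GamW (v.1.1, (q v).2), v.2).
have KE t w g : K (w, g, t) =
    GamW_add (fun z => H1 (z, t)) (fun z => H2 (z, t)) (to_GamW (w, g)).
  by rewrite (GamW_addE (H1P t) (H2P t)).
apply: (@GamW_htpy _ _ _ _ _ _ _ _ K).
- have cq : continuous q.
    exact: (cts_o (conu_cts C) (@cts_fst_snd _ _ _)).
  have cw : continuous (fun v : W * Gam * R => v.1.1).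
    exact: cts_fst_fst.
  rewrite /K; apply: (@wings_glue _ _ q) => //.
  + by move=> v; exact: conu_wingsP.
  + apply: (cts_o cH1); apply: cts_pair; last exact: cts_snd.
    apply: (cts_o to_GamW_continuous); apply: cts_pair => //.
    exact: (cts_comp _ (@cts_fst _ _)).
  + apply: (cts_o cH2); apply: cts_pair; last exact: cts_snd.
    apply: (cts_o to_GamW_continuous); apply: cts_pair => //.
    exact: (cts_comp _ (@cts_snd _ _)).
  + by move=> v -> /=; rewrite (H1P _).2 (H2P _).1.
- by move=> w g; rewrite KE e10 e20.
- by move=> w g; rewrite KE e11 e21.
- by move=> w t; rewrite KE (GamW_add_triple (H1P t) (H2P t)).1.
- by move=> w t; rewrite KE (GamW_add_triple (H1P t) (H2P t)).2.
Qed.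

Lemma GamW_add_continuous y1 y2 y3 f1 f2 :
  triple_map y1 y2 f1 -> triple_map y2 y3 f2 ->
  continuous f1 -> continuous f2 -> continuous (GamW_add f1 f2).
Proof.
move=> t1 t2 c1 c2; apply: GamW_continuous.
rewrite (_ : _ \o _ = fun p : W * Gam => if (conu C p.2).2 == zero
  then f1 (to_GamW (p.1, (conu C p.2).1))
  else f2 (to_GamW (p.1, (conu C p.2).2))); last first.
  by apply/funext => -[w g]; rewrite /= (GamW_addE t1 t2).
have cn : continuous (fun p : W * Gam => conu C p.2).
  by apply: (cts_o (conu_cts C)); exact: cts_snd.
apply: (@wings_glue _ _ (fun p => conu C p.2)) => //.
- by move=> v; exact: conu_wingsP.
- rewrite ?/K; apply: (cts_o c1); apply: (cts_o to_GamW_continuous).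
  by apply: cts_pair; [exact: cts_fst|exact: (cts_comp _ (@cts_fst _ _))].
- rewrite ?/K; apply: (cts_o c2); apply: (cts_o to_GamW_continuous).
  by apply: cts_pair; [exact: cts_fst|exact: (cts_comp _ (@cts_snd _ _))].
- by move=> v -> /=; rewrite t1.2 t2.1.
Qed.

Lemma GamW_revE y1 y2 f : triple_map y1 y2 f ->
  forall w g, GamW_rev f (to_GamW (w, g)) = f (to_GamW (w, coeta C g)).
Proof.
move=> [f0 f1] w g.
pose F (p : W * Gam) := let: (w, g) := p in f (to_GamW (w, coeta C g)).
rewrite /GamW_rev -/(F _) (@repr_to_GamW _ _ _ _ y2 y1)// => w' /=.
  by rewrite coeta_zero.
by rewrite coeta_one.
Qed.

Lemma GamW_rev_triple y1 y2 f :
  triple_map y1 y2 f -> triple_map y2 y1 (GamW_rev f).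
Proof.
move=> t; split=> w; rewrite (GamW_revE t) ?coeta_zero ?coeta_one.
  exact: t.2.
exact: t.1.
Qed.

Lemma GamW_rev_continuous y1 y2 f :
  triple_map y1 y2 f -> continuous f -> continuous (GamW_rev f).
Proof.
move=> t cf; apply: GamW_continuous.
rewrite (_ : _ \o _ = fun p : W * Gam => f (to_GamW (p.1, coeta C p.2))).
  apply: (cts_o cf); apply: (cts_o to_GamW_continuous); apply: cts_pair.
    exact: cts_fst.
  by apply: (cts_o (coeta_cts C)); exact: cts_snd.
by apply/funext => -[w g]; rewrite /= (GamW_revE t).
Qed.

Lemma GamW_rev_homotopic y1 y2 f f' :
  homotopic_through R (triple_map y1 y2) f f' ->
  homotopic_through R (triple_map y2 y1) (GamW_rev f) (GamW_rev f').
Proof.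
move=> /homotopic_throughP[H [cH H0 H1 HP]].
have e0 : (fun z => H (z, 0)) = f by apply/funext => z; exact: H0.
have e1 : (fun z => H (z, 1)) = f' by apply/funext => z; exact: H1.
pose K (v : W * Gam * R) := H (to_GamW (v.1.1, coeta C v.1.2), v.2).
have KE t w g : K (w, g, t) = GamW_rev (fun z => H (z, t)) (to_GamW (w, g)).
  by rewrite (GamW_revE (HP t)).
apply: (@GamW_htpy _ _ _ _ _ _ _ _ K).
- rewrite ?/K; apply: (cts_o cH); apply: cts_pair; last exact: cts_snd.
  apply: (cts_o to_GamW_continuous); apply: cts_pair.
    exact: cts_fst_fst.
  exact: (cts_o (coeta_cts C) (@cts_fst_snd _ _ _)).
- by move=> w g; rewrite KE e0.
- by move=> w g; rewrite KE e1.
- by move=> w t; rewrite KE (GamW_rev_triple (HP t)).1.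
- by move=> w t; rewrite KE (GamW_rev_triple (HP t)).2.
Qed.

Lemma GamW_precomp_htpy (e1 e2 : Gam) y1 y2 y1' y2' f f1 f2 (k1 k2 : Gam -> Gam) :
  triple_map y1' y2' f -> continuous f ->
  homotopic_through R (fun h : Gam -> Gam => h zero = e1 /\ h one = e2) k1 k2 ->
  (forall w, f (to_GamW (w, e1)) = y1) -> (forall w, f (to_GamW (w, e2)) = y2) ->
  (forall w g, f1 (to_GamW (w, g)) = f (to_GamW (w, k1 g))) ->
  (forall w g, f2 (to_GamW (w, g)) = f (to_GamW (w, k2 g))) ->
  homotopic_through R (triple_map y1 y2) f1 f2.
Proof.
move=> t cf /homotopic_throughP[H [cH H0 H1 HP]] fe1 fe2 f1E f2E.
pose K (v : W * Gam * R) := f (to_GamW (v.1.1, H (v.1.2, v.2))).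
apply: (@GamW_htpy _ _ _ _ _ _ _ _ K).
- rewrite ?/K; apply: (cts_o cf); apply: (cts_o to_GamW_continuous); apply: cts_pair.
    exact: cts_fst_fst.
  apply: (cts_o cH); apply: cts_pair; last exact: cts_snd.
  exact: cts_fst_snd.
- by move=> w g; rewrite f1E /K/= H0.
- by move=> w g; rewrite f2E /K/= H1.
- by move=> w s; rewrite /K/= (HP s).1.
- by move=> w s; rewrite /K/= (HP s).2.
Qed.

Lemma GamW_addA y1 y2 y3 y4 f1 f2 f3 :
  triple_map y1 y2 f1 -> triple_map y2 y3 f2 -> triple_map y3 y4 f3 ->
  continuous f1 -> continuous f2 -> continuous f3 ->
  homotopic_through R (triple_map y1 y4)
    (GamW_add f1 (GamW_add f2 f3)) (GamW_add (GamW_add f1 f2) f3).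
Proof.
move=> t1 t2 t3 c1 c2 c3; have t12 := GamW_add_triple t1 t2.
have t23 := GamW_add_triple t2 t3.
have /homotopic_throughP[H [cH H0 H1 HP]] := coassoc C.
pose F (w : W) (x : Gam * Gam * Gam) := if x.2 == zero
  then (if x.1.2 == zero then f1 (to_GamW (w, x.1.1))
        else f2 (to_GamW (w, x.1.2)))
  else f3 (to_GamW (w, x.2)).
pose K (v : W * Gam * R) := F v.1.1 (H (v.1.2, v.2)).
have cw : continuous (fun v : W * Gam * R => v.1.1).
  exact: cts_fst_fst.
have cHv : continuous (fun v : W * Gam * R => H (v.1.2, v.2)).
  apply: (cts_o cH); apply: cts_pair; last exact: cts_snd.
  exact: cts_fst_snd.
have cx1 : continuous (fun v : W * Gam * R => (H (v.1.2, v.2)).1).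
  exact: cts_comp cHv (@cts_fst _ _).
have cx11 : continuous (fun v : W * Gam * R => (H (v.1.2, v.2)).1.1).
  exact: cts_comp cx1 (@cts_fst _ _).
have cx12 : continuous (fun v : W * Gam * R => (H (v.1.2, v.2)).1.2).
  exact: cts_comp cx1 (@cts_snd _ _).
have cx2 : continuous (fun v : W * Gam * R => (H (v.1.2, v.2)).2).
  exact: cts_comp cHv (@cts_snd _ _).
have Hw g t := let: And3 h _ _ := HP t in h g.
apply: (@GamW_htpy _ _ _ _ _ _ _ _ K).
- rewrite /K /F; apply: (@wings_glue _ _ (fun v : W * Gam * R =>
    ((H (v.1.2, v.2)).1.2, (H (v.1.2, v.2)).2))).
  + exact: cts_pair.
  + move=> v; have := Hw v.1.2 v.2.
    by move=> [[[g _ <-]|[g _ <-]]|[g _ <-]] /=; [left|left|right].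
  + apply: (@wings_glue _ _ (fun v : W * Gam * R => (H (v.1.2, v.2)).1)) => //.
    * move=> v; have := Hw v.1.2 v.2.
      by move=> [[[g _ <-]|[g _ <-]]|[g _ <-]] /=; [left|right|right].
    * apply: (cts_o c1); apply: (cts_o to_GamW_continuous).
      exact: cts_pair.
    * apply: (cts_o c2); apply: (cts_o to_GamW_continuous).
      exact: cts_pair.
    * by move=> v -> /=; rewrite t1.2 t2.1.
  + apply: (cts_o c3); apply: (cts_o to_GamW_continuous).
    exact: cts_pair.
  + by move=> v [-> ->] /=; rewrite one_neq_zero t2.2 t3.1.
- move=> w g; rewrite /K /= H0//= (GamW_addE t1 t23) /on_wings/=.
  case: ifPn => n2 /=; first by rewrite /F/= !eqxx.
  rewrite /F/= (GamW_addE t2 t3); case: ifPn => // n3.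
  by case: eqP => // ->; rewrite t1.2 t2.1.
- move=> w g; rewrite /K /= H1//= (GamW_addE t12 t3) /on_wings/=.
  case: ifPn => n2 /=; rewrite /F/=.
    by rewrite eqxx (GamW_addE t1 t2).
  by rewrite (negbTE n2).
- by move=> w t; rewrite /K /F/=; have [_ -> _] := HP t; rewrite /= !eqxx t1.1.
- move=> w t; rewrite /K /F/=; have [_ _ ->] := HP t.
  by rewrite /= one_neq_zero t3.2.
Qed.

Lemma GamW_add0 y1 y2 f : triple_map y1 y2 f -> continuous f ->
  homotopic_through R (triple_map y1 y2) (GamW_add (cst y1) f) f.
Proof.
move=> t cf; have t0 : triple_map y1 y1 (cst y1 : GamW Gam W -> Y) by [].
apply: (GamW_precomp_htpy t cf (conu_snd C) t.1 t.2) => // w g.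
rewrite (GamW_addE t0 t)/=; case: eqP => // ->; by rewrite t.1.
Qed.

Lemma GamW_addr0 y1 y2 f : triple_map y1 y2 f -> continuous f ->
  homotopic_through R (triple_map y1 y2) (GamW_add f (cst y2)) f.
Proof.
move=> t cf; have t0 : triple_map y2 y2 (cst y2 : GamW Gam W -> Y) by [].
apply: (GamW_precomp_htpy t cf (conu_fst C) t.1 t.2) => // w g.
rewrite (GamW_addE t t0)/=; case: eqP => // n2.
by case: (conu_wingsP g) => // ->; rewrite t.2.
Qed.

Lemma GamW_addrN y1 y2 f : triple_map y1 y2 f -> continuous f ->
  homotopic_through R (triple_map y1 y1) (GamW_add f (GamW_rev f)) (cst y1).
Proof.
move=> t cf; have t' := GamW_rev_triple t.
apply: (GamW_precomp_htpy t cf (coinvr C) t.1 t.1) => w g.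
  by rewrite (GamW_addE t t')/= /on_wings; case: ifP => // _; rewrite (GamW_revE t).
by rewrite /= t.1.
Qed.

Lemma GamW_addNr y1 y2 f : triple_map y1 y2 f -> continuous f ->
  homotopic_through R (triple_map y2 y2) (GamW_add (GamW_rev f) f) (cst y2).
Proof.
move=> t cf; have t' := GamW_rev_triple t.
apply: (GamW_precomp_htpy t cf (coinvl C) t.2 t.2) => w g.
  by rewrite (GamW_addE t' t)/= /on_wings; case: ifP => // _; rewrite (GamW_revE t).
by rewrite /= t.2.
Qed.

End sum.
End GamW_sum.

Record continuous_action (G : groupType) (Y : topologicalType) :=
  ContinuousAction {
    gact :> G -> Y -> Y;
    gact1 : forall y, gact 1%g y = y;
    gactM : forall g h y, gact (g * h)%g y = gact g (gact h y);
    gact_cts : forall g, continuous (gact g)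
  }.

Section triple_postcomp.
Context {Gam : bpTopologicalType} {W Y Z : topologicalType}.

Lemma triple_comp (k : Y -> Z) y1 y2 (f : GamW Gam W -> Y) :
  triple_map y1 y2 f -> triple_map (k y1) (k y2) (k \o f).
Proof. by move=> [f0 f1]; split=> w /=; rewrite ?f0 ?f1. Qed.

Lemma triple_comp_homotopic (R : realType) (k : Y -> Z) y1 y2
    (f f' : GamW Gam W -> Y) :
  continuous k -> homotopic_through R (triple_map y1 y2) f f' ->
  homotopic_through R (triple_map (k y1) (k y2)) (k \o f) (k \o f').
Proof.
move=> ck /homotopic_throughP[H [cH H0 H1 HP]]; apply/homotopic_throughP.
exists (fun p => k (H p)); split=> [|z t t0|z t t1|t].
- exact: (cts_comp cH ck).
- by rewrite H0.
- by rewrite H1.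
- exact: (triple_comp k (HP t)).
Qed.

End triple_postcomp.

Section rhodes_def.
Context {R : realType} {Gam : bpTopologicalType} (C : cogrouplike Gam R).
Context (W : topologicalType).
Context {G : groupType} {Y : topologicalType} (a : continuous_action G Y).
Context (y0 : Y).

Record rhodes_map := RhodesMap {
  rhodes_fun : GamW Gam W -> Y;
  rhodes_elt : G;
  rhodes_cts : continuous rhodes_fun;
  rhodes_triple : triple_map y0 (a rhodes_elt y0) rhodes_fun
}.

HB.instance Definition _ := gen_eqMixin rhodes_map.
HB.instance Definition _ := gen_choiceMixin rhodes_map.

Let rhodes_rel' (m n : rhodes_map) : bool :=
  `[< rhodes_elt m = rhodes_elt n /\
      homotopic_through R (triple_map y0 (a (rhodes_elt m) y0))
        (rhodes_fun m) (rhodes_fun n) >].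

Let rhodes_refl : reflexive rhodes_rel'.
Proof.
move=> m; apply/asboolP; split=> //; apply: homotopic_refl => //.
  exact: rhodes_cts.
exact: rhodes_triple.
Qed.

Let rhodes_sym : symmetric rhodes_rel'.
Proof.
have sub m n : rhodes_rel' m n -> rhodes_rel' n m.
  move=> /asboolP[e h]; apply/asboolP; split=> //; rewrite -e.
  exact: homotopic_sym.
by move=> m n; apply/idP/idP; exact: sub.
Qed.

Let rhodes_trans : transitive rhodes_rel'.
Proof.
move=> n m p /asboolP[e h] /asboolP[e' h']; apply/asboolP.
split; first by rewrite e.
by apply: homotopic_trans h _; rewrite e.
Qed.

Definition rhodes_rel :=
  EquivRel rhodes_rel' rhodes_refl rhodes_sym rhodes_trans.

(* [C] is recorded in the type because the group law depends on it. *)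
Definition rhodes : Type := let _ := C in {eq_quot rhodes_rel}.

HB.instance Definition _ := Choice.on rhodes.
HB.instance Definition _ := Quotient.on rhodes.

Definition rhodes_class (m : rhodes_map) : rhodes := \pi_rhodes m.

Lemma rhodes_classP m n : rhodes_class m = rhodes_class n <->
  rhodes_elt m = rhodes_elt n /\
  homotopic_through R (triple_map y0 (a (rhodes_elt m) y0))
    (rhodes_fun m) (rhodes_fun n).
Proof. by split=> [/eqmodP/asboolP//|?]; apply/eqmodP/asboolP. Qed.

Lemma rhodes_repr z : rhodes_class (repr z) = z.
Proof. exact: reprK. Qed.

Let unit_triple : triple_map y0 (a 1%g y0) (cst y0 : GamW Gam W -> Y).
Proof. by rewrite gact1. Qed.

Definition rhodes_unit : rhodes_map :=
  RhodesMap (@cst_continuous _ _ y0) unit_triple.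

Let act_triple (g : G) (m : rhodes_map) : triple_map (a g y0)
  (a (g * rhodes_elt m)%g y0) (a g \o rhodes_fun m).
Proof. rewrite gactM; exact/triple_comp/rhodes_triple. Qed.

Let act_continuous (g : G) (m : rhodes_map) : continuous (a g \o rhodes_fun m).
Proof. exact: (cts_comp (@rhodes_cts m) (@gact_cts _ _ a g)). Qed.

Let mul_continuous (m n : rhodes_map) :
  continuous (GamW_add C (rhodes_fun m) (a (rhodes_elt m) \o rhodes_fun n)).
Proof.
apply: (GamW_add_continuous (C := C) (rhodes_triple m) (act_triple _ n)).
  exact: rhodes_cts.
exact: act_continuous.
Qed.

Let mul_triple (m n : rhodes_map) :
  triple_map y0 (a (rhodes_elt m * rhodes_elt n)%g y0)
    (GamW_add C (rhodes_fun m) (a (rhodes_elt m) \o rhodes_fun n)).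
Proof. exact: (GamW_add_triple _ (rhodes_triple m) (act_triple _ n)). Qed.

Definition rhodes_map_mul (m n : rhodes_map) : rhodes_map :=
  RhodesMap (@mul_continuous m n) (mul_triple m n).

Let inv_triple0 (m : rhodes_map) :
  triple_map (a (rhodes_elt m)^-1%g y0) y0
    (a (rhodes_elt m)^-1%g \o rhodes_fun m).
Proof.
have := triple_comp (a (rhodes_elt m)^-1%g) (rhodes_triple m).
by rewrite -gactM mulVg gact1.
Qed.

Let inv_continuous (m : rhodes_map) :
  continuous (GamW_rev C (a (rhodes_elt m)^-1%g \o rhodes_fun m)).
Proof. exact: (GamW_rev_continuous (C := C) (inv_triple0 m) (@act_continuous _ m)). Qed.

Let inv_triple (m : rhodes_map) :
  triple_map y0 (a (rhodes_elt m)^-1%g y0)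
    (GamW_rev C (a (rhodes_elt m)^-1%g \o rhodes_fun m)).
Proof. exact: (GamW_rev_triple _ (inv_triple0 m)). Qed.

Definition rhodes_map_inv (m : rhodes_map) : rhodes_map :=
  RhodesMap (@inv_continuous m) (inv_triple m).

Definition rhodes_one : rhodes := rhodes_class rhodes_unit.
Definition rhodes_mul (x y : rhodes) : rhodes :=
  rhodes_class (rhodes_map_mul (repr x) (repr y)).
Definition rhodes_inv (x : rhodes) : rhodes :=
  rhodes_class (rhodes_map_inv (repr x)).

Lemma rhodes_mulE m n :
  rhodes_mul (rhodes_class m) (rhodes_class n) =
  rhodes_class (rhodes_map_mul m n).
Proof.
have /rhodes_classP[em hm] := rhodes_repr (rhodes_class m).
have /rhodes_classP[en hn] := rhodes_repr (rhodes_class n).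
apply/rhodes_classP; rewrite /= em en; split=> //.
apply: (GamW_add_homotopic C (y2 := a (rhodes_elt m) y0)).
  by rewrite -em.
rewrite gactM; apply: triple_comp_homotopic; first exact: gact_cts.
by rewrite -en.
Qed.

Lemma rhodes_invE m :
  rhodes_inv (rhodes_class m) = rhodes_class (rhodes_map_inv m).
Proof.
have /rhodes_classP[em hm] := rhodes_repr (rhodes_class m).
apply/rhodes_classP; rewrite /= em; split=> //.
apply: GamW_rev_homotopic.
have {2}-> : y0 = a (rhodes_elt m)^-1%g (a (rhodes_elt m) y0).
  by rewrite -gactM mulVg gact1.
by apply: triple_comp_homotopic; [exact: gact_cts|rewrite -em].
Qed.

Let mulA : associative rhodes_mul.
Proof.
move=> x y z; rewrite -(rhodes_repr x) -(rhodes_repr y) -(rhodes_repr z).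
move: (repr x) (repr y) (repr z) => m n p.
rewrite !rhodes_mulE; apply/rhodes_classP => /=; split; first by rewrite mulgA.
have -> : a (rhodes_elt m) \o
    GamW_add C (rhodes_fun n) (a (rhodes_elt n) \o rhodes_fun p) =
    GamW_add C (a (rhodes_elt m) \o rhodes_fun n)
      (a (rhodes_elt m * rhodes_elt n)%g \o rhodes_fun p).
  apply/funext => z' /=; rewrite /GamW_add; case: (repr z') => w g.
  by rewrite /on_wings; case: ifP => // _ /=; rewrite gactM.
rewrite mulgA; apply: (@GamW_addA _ _ C _ _ y0 (a (rhodes_elt m) y0)
  (a (rhodes_elt m * rhodes_elt n)%g y0)) => //.
- exact: rhodes_triple.
- exact: rhodes_cts.
Qed.

Let mul1 : left_id rhodes_one rhodes_mul.
Proof.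
move=> x; rewrite -(rhodes_repr x); move: (repr x) => m.
rewrite /rhodes_one rhodes_mulE; apply/rhodes_classP => /=.
split; first by rewrite mul1g.
rewrite (_ : a 1%g \o _ = rhodes_fun m); last first.
  by apply/funext => z /=; rewrite gact1.
rewrite mul1g; apply: GamW_add0; [exact: rhodes_triple|exact: rhodes_cts].
Qed.

Let mulr1 : right_id rhodes_one rhodes_mul.
Proof.
move=> x; rewrite -(rhodes_repr x); move: (repr x) => m.
rewrite /rhodes_one rhodes_mulE; apply/rhodes_classP => /=.
split; first by rewrite mulg1.
rewrite mulg1; apply: GamW_addr0; [exact: rhodes_triple|exact: rhodes_cts].
Qed.

Let mulV : left_inverse rhodes_one rhodes_inv rhodes_mul.
Proof.
move=> x; rewrite -(rhodes_repr x); move: (repr x) => m.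
rewrite /rhodes_one rhodes_invE rhodes_mulE; apply/rhodes_classP => /=.
rewrite mulVg gact1; split=> //.
exact: (GamW_addNr C (inv_triple0 m) (@act_continuous _ m)).
Qed.

Let mulrV : right_inverse rhodes_one rhodes_inv rhodes_mul.
Proof.
move=> x; rewrite -(rhodes_repr x); move: (repr x) => m.
rewrite /rhodes_one rhodes_invE rhodes_mulE; apply/rhodes_classP => /=.
rewrite mulgV gact1; split=> //.
rewrite (_ : a _ \o _ = GamW_rev C (rhodes_fun m)); last first.
  apply/funext => z /=; rewrite /GamW_rev; case: (repr z) => w g /=.
  by rewrite -gactM mulgV gact1.
exact: (GamW_addrN C (rhodes_triple m) (@rhodes_cts m)).
Qed.

HB.instance Definition _ := isGroup.Build rhodes mulA mul1 mulr1 mulV mulrV.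

Definition rhodes_proj (x : rhodes) : G := rhodes_elt (repr x).

Lemma rhodes_projE m : rhodes_proj (rhodes_class m) = rhodes_elt m.
Proof. by have /rhodes_classP[] := rhodes_repr (rhodes_class m). Qed.

End rhodes_def.
Arguments rhodes_proj {R Gam C W G Y a y0} x.
Arguments rhodes_map Gam W {G Y} a y0.

Section GamSmash_facts.
Context {R : realType} {Gam : bpTopologicalType} (C : cogrouplike Gam R).
Context {W : topologicalType}.

Definition GamSmash_pt : GamSmash Gam W := to_GamSmash (to_Gam0 zero, None).

Lemma to_Gam0P (g h : Gam) : to_Gam0 g = to_Gam0 h <->
  g = h \/ ((g = zero \/ g = one) /\ (h = zero \/ h = one)).
Proof.
by split=> [/eqmodP/collapse_relP//|H]; exact/eqmodP/collapse_relP.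
Qed.

Lemma to_Gam0_one : to_Gam0 one = to_Gam0 zero :> Gam0 Gam.
Proof. by apply/to_Gam0P; right; split; [right|left]. Qed.

Lemma to_GamSmashP (p q : Gam0 Gam * adjoin_point W) :
  to_GamSmash p = to_GamSmash q <-> p = q \/
  ((p.2 = None \/ p.1 = to_Gam0 zero) /\ (q.2 = None \/ q.1 = to_Gam0 zero)).
Proof.
have wP (r : Gam0 Gam * adjoin_point W) :
    ([set: Gam0 Gam] `*` [set None] `|`
      [set to_Gam0 zero] `*` [set: adjoin_point W]) r <->
    (r.2 = None \/ r.1 = to_Gam0 zero).
  by split=> [[[_ ?]|[? _]]|[?|?]]; by [left|right].
split=> [/eqmodP/collapse_relP[->|[/wP ? /wP ?]]|[->//|[/wP ? /wP ?]]].
- by left.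
- by right.
- by apply/eqmodP/collapse_relP; right.
Qed.

Lemma GamSmash_ind (P : GamSmash Gam W -> Prop) :
  P GamSmash_pt -> (forall g w, P (to_GamSmash (to_Gam0 g, Some w))) ->
  forall z, P z.
Proof.
move=> P0 P1 z; rewrite -[z]reprK -/(to_GamSmash _).
case: (repr z) => x; rewrite -[x]reprK -/(to_Gam0 _); case=> [w|]; first exact: P1.
rewrite (_ : to_GamSmash _ = GamSmash_pt)//.
by apply/to_GamSmashP; right; split; left.
Qed.

Lemma repr_to_GamSmash (B : Type) (F : Gam * adjoin_point W -> B) (b : B) :
  (forall g, F (g, None) = b) -> (forall v, F (zero, v) = b) ->
  (forall v, F (one, v) = b) ->
  forall g v, let p := repr (to_GamSmash (to_Gam0 g, v)) in
  F (repr p.1, p.2) = F (g, v).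
Proof.
move=> FN F0 F1 g v p.
have Fpt h v' : (v' = None \/ to_Gam0 h = to_Gam0 zero) -> F (h, v') = b.
  case=> [->//|/to_Gam0P[->//|[[->|->] _]]]; by rewrite ?F0 ?F1.
have p1K : to_Gam0 (repr p.1) = p.1 by exact: reprK.
have /to_GamSmashP[pE|[pw gw]] :
    to_GamSmash p = to_GamSmash (to_Gam0 g, v) by exact: reprK.
  rewrite pE /=; have /to_Gam0P[->//|[h0 g0]] :
    to_Gam0 (repr (to_Gam0 g)) = to_Gam0 g by exact: reprK.
  by case: h0 => ->; case: g0 => ->; rewrite ?F0 ?F1.
by rewrite !Fpt//= p1K.
Qed.

Lemma GamW_quotE w g :
  GamW_quot (to_GamW (w, g)) = to_GamSmash (to_Gam0 g, Some w) :> GamSmash Gam W.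
Proof.
rewrite /GamW_quot.
apply: (@repr_to_GamW _ _ _ (fun p : W * Gam =>
  to_GamSmash (to_Gam0 p.2, Some p.1)) GamSmash_pt GamSmash_pt) => w' /=;
  apply/to_GamSmashP; right; split; rewrite /= ?to_Gam0_one; by [left|right].
Qed.

Lemma GamW_quot_zero w : GamW_quot (to_GamW (w, zero)) = GamSmash_pt.
Proof. by rewrite GamW_quotE; apply/to_GamSmashP; right; split; [right|left]. Qed.

Lemma GamW_quot_one w : GamW_quot (to_GamW (w, one)) = GamSmash_pt.
Proof.
by rewrite GamW_quotE to_Gam0_one; apply/to_GamSmashP; right; split; [right|left].
Qed.

Lemma to_Gam0_continuous : continuous (@to_Gam0 Gam).
Proof. exact: pi_continuous. Qed.

Lemma adjoin_point_Some_continuous : continuous (Some : W -> adjoin_point W).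
Proof. by apply/continuousP. Qed.

Lemma GamW_quot_continuous : continuous (@GamW_quot Gam W).
Proof.
apply: GamW_continuous.
rewrite (_ : _ \o _ =
    fun p : W * Gam => to_GamSmash (to_Gam0 p.2, Some p.1)); last first.
  by apply/funext => -[w g]; rewrite /= GamW_quotE.
apply: (cts_comp (g := @to_GamSmash Gam W)) (@pi_continuous _ _).
apply: cts_pair; first exact: (cts_o to_Gam0_continuous (@cts_snd _ _)).
exact: (cts_o adjoin_point_Some_continuous (@cts_fst _ _)).
Qed.

Lemma Gam0_nbhs (S : set Gam) g : open S -> S g -> (S zero <-> S one) ->
  nbhs (to_Gam0 g) (@to_Gam0 Gam @` S).
Proof.
move=> oS Sg S01; apply: open_nbhs_nbhs; split; last by exists g.
rewrite /open/= /quotient_open.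
rewrite (_ : _ @^-1` _ = S)//; apply/seteqP; split=> [h [k Sk /to_Gam0P]|h Sh].
  by move=> [<-//|[[ke|ke] [->|->]]]; move: Sk; rewrite ke ?S01// -?S01.
by exists h.
Qed.

Lemma Gam0_prod_continuous (V Z : topologicalType) (f : Gam0 Gam * V -> Z) :
  continuous (fun p : Gam * V => f (to_Gam0 p.1, p.2)) -> continuous f.
Proof.
move=> cf [x v]; rewrite -[x]reprK -/(to_Gam0 _); move: (repr x) => {x} g U.
have cfU h : to_Gam0 h = to_Gam0 g -> nbhs (f (to_Gam0 g, v)) U ->
    exists A B, [/\ open A, A h, nbhs v B &
      forall h' v', A h' -> B v' -> U (f (to_Gam0 h', v'))].
  move=> hg nU; have := cf (h, v) U; rewrite /= hg => /(_ nU)[[A B] /= [Ah Bv] AB].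
  exists A^°, B; split=> //; first exact: open_interior.
  by move=> h' v' /interior_subset Ah' Bv'; exact: (AB (h', v')).
move=> nU.
have [S [B [oS Sg S01 Bv SB]]] : exists S B, [/\ open S, S g, S zero <-> S one,
    nbhs v B & forall h' v', S h' -> B v' -> U (f (to_Gam0 h', v'))].
  have [g01|g01] := pselect (g = zero \/ g = one).
    have e0 : to_Gam0 zero = to_Gam0 g.
      by case: g01 => ->; rewrite ?to_Gam0_one.
    have e1 : to_Gam0 one = to_Gam0 g by rewrite to_Gam0_one.
    have [A0 [B0 [oA0 A0z B0v AB0]]] := cfU _ e0 nU.
    have [A1 [B1 [oA1 A1z B1v AB1]]] := cfU _ e1 nU.
    exists (A0 `|` A1), (B0 `&` B1); split.
    - exact: openU.
    - by case: g01 => ->; [left|right].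
    - by split=> _; [right|left].
    - exact: filterI.
    - by move=> h' v' [A0h|A1h] [B0v' B1v']; [exact: AB0|exact: AB1].
  have [A [B [oA Ag Bv AB]]] := cfU g erefl nU.
  exists (A `&` ~` ([set zero] `|` [set one])), B; split=> //.
  - apply: openI => //; apply: closed_openC; apply: closedU.
      exact: (closed_zero C).
    exact: (closed_one C).
  - by split=> [[_]|[_]] /= []; by [left|right].
  - by move=> h' v' [Ah' _] Bv'; exact: AB.
exists (@to_Gam0 Gam @` S, B) => /=.
  by split=> //; exact: Gam0_nbhs.
by move=> [x' v'] /= [[h Sh <-] Bv']; exact: SB.
Qed.

Lemma adjoin_point_prod_continuous (V Z : topologicalType)
    (f : V * adjoin_point W -> Z) (z0 : Z) :
  (forall v, f (v, None) = z0) ->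
  continuous (fun p : V * W => f (p.1, Some p.2)) -> continuous f.
Proof.
move=> f0 cf [v [w|]] U; last first.
  rewrite f0 => nU; exists (setT, [set None]).
    split; first exact: filterT.
    apply: open_nbhs_nbhs; split=> //.
    rewrite /open/= (_ : _ @^-1` _ = set0); first exact: open0.
    by apply/seteqP; split.
  by move=> [v' p] /= [_ ->]; rewrite f0; exact: nbhs_singleton nU.
move=> nU; have [[A B] /= [Av Bw] AB] := cf (v, w) U nU.
exists (A, [set Some x | x in B^°]).
  split=> //; apply: open_nbhs_nbhs; split; last by exists w.
  rewrite /open/= (_ : _ @^-1` _ = B^°); first exact: open_interior.
  by apply/seteqP; split=> x /=; [move=> [? ? [<-]]|exists x].
by move=> [v' p] /= [Av' [x /interior_subset Bx <-]]; exact: (AB (v', x)).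
Qed.

Lemma GamSmash_prodR_continuous (Z : topologicalType) (z0 : Z)
    (H : GamSmash Gam W * R -> Z) :
  (forall t, H (GamSmash_pt, t) = z0) ->
  continuous (fun p : W * Gam * R =>
    H (to_GamSmash (to_Gam0 p.1.2, Some p.1.1), p.2)) ->
  continuous H.
Proof.
move=> H0 cH; apply: quotient_prodR_continuous => /=.
pose f1 (p : Gam0 Gam * (W * R)) : Z :=
  H (to_GamSmash (p.1, Some p.2.1), p.2.2).
have cf1 : continuous f1.
  apply: Gam0_prod_continuous; rewrite /f1/=.
  apply: (cts_comp (f := fun p : Gam * (W * R) => (p.2.1, p.1, p.2.2)) _ cH).
  apply: cts_pair; last exact: (cts_comp (@cts_snd _ _) (@cts_snd _ _)).
  apply: cts_pair; last exact: cts_fst.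
  exact: (cts_comp (@cts_snd _ _) (@cts_fst _ _)).
pose f2 (p : (Gam0 Gam * R) * adjoin_point W) : Z :=
  H (to_GamSmash (p.1.1, p.2), p.1.2).
have cf2 : continuous f2.
  apply: (@adjoin_point_prod_continuous _ _ _ z0); rewrite /f2/=.
    move=> v; rewrite (_ : to_GamSmash _ = GamSmash_pt)//.
    by apply/to_GamSmashP; right; split; left.
  apply: (cts_comp (f := fun p : Gam0 Gam * R * W => (p.1.1, (p.2, p.1.2))) _ cf1).
  apply: cts_pair; first exact: cts_fst_fst.
  by apply: cts_pair; [exact: cts_snd|exact: cts_fst_snd].
rewrite (_ : (fun _ => _) = fun p : Gam0 Gam * adjoin_point W * R =>
  f2 (p.1.1, p.2, p.1.2)); last by apply/funext => -[[]].
apply: (cts_o cf2).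
apply: cts_pair; last exact: cts_fst_snd.
by apply: cts_pair; [exact: cts_fst_fst|exact: cts_snd].
Qed.

Section fox_maps.
Context {Y : topologicalType} (y0 : Y).
Implicit Types (f : GamSmash Gam W -> Y).

Definition pointed_map f : Prop := f GamSmash_pt = y0.

Lemma GamSmash_continuous f : pointed_map f ->
  continuous (f \o @GamW_quot Gam W) -> continuous f.
Proof.
move=> f0 cf; have : continuous (fun p : GamSmash Gam W * R => f p.1).
  apply: (@GamSmash_prodR_continuous _ y0) => //=.
  rewrite (_ : (fun _ => _) = fun p : W * Gam * R =>
    (f \o @GamW_quot Gam W) (to_GamW p.1)); last first.
    by apply/funext => -[[w g] t] /=; rewrite GamW_quotE.
  apply: cts_o => //; apply: cts_o; last exact: cts_fst.
  exact: to_GamW_continuous.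
move=> cF; have c0 : continuous (fun z : GamSmash Gam W => (z, 0 : R)).
  by apply: cts_pair; [move=> z; exact: cvg_id|exact: cst_continuous].
exact: (cts_comp c0 cF).
Qed.

Lemma pointed_triple f : pointed_map f ->
  triple_map y0 y0 (f \o @GamW_quot Gam W).
Proof. by move=> f0; split=> w /=; rewrite ?GamW_quot_zero ?GamW_quot_one. Qed.

Lemma GamSmash_homotopicP f f' : pointed_map f -> pointed_map f' ->
  homotopic_through R pointed_map f f' <->
  homotopic_through R (triple_map y0 y0) (f \o @GamW_quot Gam W)
    (f' \o @GamW_quot Gam W).
Proof.
move=> f0 f0'; split=> /homotopic_throughP[H [cH H0 H1 HP]];
    apply/homotopic_throughP.
  exists (fun p => H (GamW_quot p.1, p.2)); split=> [|z t t0|z t t1|t].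
  - apply: (cts_o cH); apply: cts_pair; last exact: cts_snd.
    exact: (cts_o GamW_quot_continuous (@cts_fst _ _)).
  - by rewrite H0.
  - by rewrite H1.
  - exact: (pointed_triple (HP t)).
pose F t (p : Gam * adjoin_point W) : Y :=
  if p.2 is Some w then H (to_GamW (w, p.1), t) else y0.
pose K (p : GamSmash Gam W * R) : Y :=
  F p.2 (repr (repr p.1).1, (repr p.1).2).
have KE t g v : K (to_GamSmash (to_Gam0 g, v), t) = F t (g, v).
  rewrite /K; apply: (@repr_to_GamSmash _ (F t) y0) => //.
    by case=> [w|//]; rewrite /F/= (HP t).1.
  by case=> [w|//]; rewrite /F/= (HP t).2.
have K0 t : K (GamSmash_pt, t) = y0 by rewrite KE.
exists K; split=> [|z t t0|z t t1|t].
- apply: (@GamSmash_prodR_continuous _ y0) => //.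
  rewrite (_ : (fun _ => _) = fun p : W * Gam * R => H (to_GamW p.1, p.2)).
    apply: (cts_o cH); apply: cts_pair; last exact: cts_snd.
    exact: (cts_o to_GamW_continuous (@cts_fst _ _)).
  by apply/funext => -[[w g] t]; rewrite KE.
- by elim/GamSmash_ind : z => [|g w]; rewrite ?K0 ?f0// KE /F/= H0//= GamW_quotE.
- by elim/GamSmash_ind : z => [|g w]; rewrite ?K0 ?f0'// KE /F/= H1//= GamW_quotE.
- exact: K0.
Qed.

(* The sum and the inverse coming from the comultiplication and the coinverse
   that [conu] and [coeta] induce on Gamma_0. *)
Definition GamSmash_add f1 f2 (z : GamSmash Gam W) : Y :=
  let: (x, v) := repr z in
  on_wings (fun g' => f1 (to_GamSmash (to_Gam0 g', v)))
    (fun g' => f2 (to_GamSmash (to_Gam0 g', v))) (conu C (repr x)).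

Definition GamSmash_rev f (z : GamSmash Gam W) : Y :=
  let: (x, v) := repr z in f (to_GamSmash (to_Gam0 (coeta C (repr x)), v)).

Lemma to_GamSmash_pt g (v : adjoin_point W) :
  (v = None \/ to_Gam0 g = to_Gam0 zero) ->
  to_GamSmash (to_Gam0 g, v) = GamSmash_pt.
Proof. by move=> h; apply/to_GamSmashP; right; split=> //; left. Qed.

Lemma GamSmash_addE f1 f2 : pointed_map f1 -> pointed_map f2 -> forall g v,
  GamSmash_add f1 f2 (to_GamSmash (to_Gam0 g, v)) =
  on_wings (fun g' => f1 (to_GamSmash (to_Gam0 g', v)))
    (fun g' => f2 (to_GamSmash (to_Gam0 g', v))) (conu C g).
Proof.
move=> p1 p2 g v.
pose F (p : Gam * adjoin_point W) : Y :=
  on_wings (fun g' => f1 (to_GamSmash (to_Gam0 g', p.2)))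
    (fun g' => f2 (to_GamSmash (to_Gam0 g', p.2))) (conu C p.1).
transitivity (F (repr (repr (to_GamSmash (to_Gam0 g, v))).1,
                 (repr (to_GamSmash (to_Gam0 g, v))).2)).
  by rewrite /GamSmash_add /F; case: (repr (to_GamSmash _)).
apply: (@repr_to_GamSmash _ F y0).
- by move=> h; rewrite /F/on_wings/=; case: ifP => _; rewrite to_GamSmash_pt//; left.
- by move=> v'; rewrite /F/on_wings conu_zero/= eqxx to_GamSmash_pt//; right.
- move=> v'; rewrite /F/on_wings conu_one/= one_neq_zero.
  by rewrite to_GamSmash_pt//; right; exact: to_Gam0_one.
Qed.

Lemma GamSmash_revE f : pointed_map f -> forall g v,
  GamSmash_rev f (to_GamSmash (to_Gam0 g, v)) =
  f (to_GamSmash (to_Gam0 (coeta C g), v)).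
Proof.
move=> p g v.
pose F (p : Gam * adjoin_point W) : Y :=
  f (to_GamSmash (to_Gam0 (coeta C p.1), p.2)).
transitivity (F (repr (repr (to_GamSmash (to_Gam0 g, v))).1,
                 (repr (to_GamSmash (to_Gam0 g, v))).2)).
  by rewrite /GamSmash_rev /F; case: (repr (to_GamSmash _)).
apply: (@repr_to_GamSmash _ F y0).
- by move=> h; rewrite /F/= to_GamSmash_pt//; left.
- move=> v'; rewrite /F/= coeta_zero to_GamSmash_pt//.
  by right; exact: to_Gam0_one.
- by move=> v'; rewrite /F/= coeta_one to_GamSmash_pt//; right.
Qed.

Lemma GamSmash_add_quot f1 f2 : pointed_map f1 -> pointed_map f2 ->
  GamSmash_add f1 f2 \o @GamW_quot Gam W =
  GamW_add C (f1 \o @GamW_quot Gam W) (f2 \o @GamW_quot Gam W).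
Proof.
move=> p1 p2; apply/funext; apply: GamW_ind => w g.
rewrite (GamW_addE C (pointed_triple p1) (pointed_triple p2)) /=.
by rewrite !GamW_quotE GamSmash_addE.
Qed.

Lemma GamSmash_rev_quot f : pointed_map f ->
  GamSmash_rev f \o @GamW_quot Gam W = GamW_rev C (f \o @GamW_quot Gam W).
Proof.
move=> p; apply/funext; apply: GamW_ind => w g.
by rewrite (GamW_revE C (pointed_triple p)) /= !GamW_quotE GamSmash_revE.
Qed.

Lemma GamSmash_add_pointed f1 f2 : pointed_map f1 -> pointed_map f2 ->
  pointed_map (GamSmash_add f1 f2).
Proof.
by move=> p1 p2; rewrite /pointed_map GamSmash_addE// conu_zero /on_wings/= eqxx.
Qed.

Lemma GamSmash_rev_pointed f : pointed_map f -> pointed_map (GamSmash_rev f).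
Proof.
move=> p; rewrite /pointed_map GamSmash_revE// coeta_zero to_GamSmash_pt//.
by left.
Qed.

Lemma GamSmash_add_continuous f1 f2 : pointed_map f1 -> pointed_map f2 ->
  continuous f1 -> continuous f2 -> continuous (GamSmash_add f1 f2).
Proof.
move=> p1 p2 c1 c2; apply: GamSmash_continuous; first exact: GamSmash_add_pointed.
rewrite GamSmash_add_quot//.
apply: (GamW_add_continuous (C := C) (pointed_triple p1) (pointed_triple p2)).
  exact: (cts_comp GamW_quot_continuous c1).
exact: (cts_comp GamW_quot_continuous c2).
Qed.

Lemma GamSmash_rev_continuous f : pointed_map f ->
  continuous f -> continuous (GamSmash_rev f).
Proof.
move=> p c; apply: GamSmash_continuous; first exact: GamSmash_rev_pointed.
rewrite GamSmash_rev_quot//.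
apply: (GamW_rev_continuous (C := C) (pointed_triple p)).
exact: (cts_comp GamW_quot_continuous c).
Qed.

End fox_maps.
End GamSmash_facts.

Section fox_def.
Context {R : realType} {Gam : bpTopologicalType} (C : cogrouplike Gam R).
Context (W : topologicalType) {Y : topologicalType} (y0 : Y).

Record fox_map := FoxMap {
  fox_fun : GamSmash Gam W -> Y;
  fox_cts : continuous fox_fun;
  fox_pointed : pointed_map y0 fox_fun
}.

HB.instance Definition _ := gen_eqMixin fox_map.
HB.instance Definition _ := gen_choiceMixin fox_map.

Let fox_rel' (m n : fox_map) : bool :=
  `[< homotopic_through R (pointed_map y0) (fox_fun m) (fox_fun n) >].

Let fox_refl : reflexive fox_rel'.
Proof.
move=> m; apply/asboolP; apply: homotopic_refl => //.
  exact: fox_cts.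
exact: fox_pointed.
Qed.

Let fox_sym : symmetric fox_rel'.
Proof.
by move=> m n; apply/idP/idP => /asboolP h; apply/asboolP; exact: homotopic_sym.
Qed.

Let fox_trans : transitive fox_rel'.
Proof.
move=> n m p /asboolP h /asboolP h'; apply/asboolP; exact: homotopic_trans h h'.
Qed.

Definition fox_rel := EquivRel fox_rel' fox_refl fox_sym fox_trans.

Definition fox : Type := let _ := C in {eq_quot fox_rel}.

HB.instance Definition _ := Choice.on fox.
HB.instance Definition _ := Quotient.on fox.

Definition fox_class (m : fox_map) : fox := \pi_fox m.

Lemma fox_classP m n : fox_class m = fox_class n <->
  homotopic_through R (pointed_map y0) (fox_fun m) (fox_fun n).
Proof. by split=> [/eqmodP/asboolP//|?]; apply/eqmodP/asboolP. Qed.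

Lemma fox_repr z : fox_class (repr z) = z.
Proof. exact: reprK. Qed.

Let fox_quot (m : fox_map) := fox_fun m \o @GamW_quot Gam W.

Let fox_quot_cts m : continuous (fox_quot m).
Proof. exact: (cts_comp GamW_quot_continuous (@fox_cts m)). Qed.

Let fox_quot_triple m : triple_map y0 y0 (fox_quot m).
Proof. exact: (pointed_triple (fox_pointed m)). Qed.

Lemma fox_class_quotP m n : fox_class m = fox_class n <->
  homotopic_through R (triple_map y0 y0) (fox_fun m \o @GamW_quot Gam W)
    (fox_fun n \o @GamW_quot Gam W).
Proof.
have h := GamSmash_homotopicP C (fox_pointed m) (fox_pointed n).
by split=> [/fox_classP/h//|/h/fox_classP].
Qed.

Definition fox_unit : fox_map :=
  @FoxMap (cst y0) (@cst_continuous _ _ y0) erefl.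

Definition fox_map_mul (m n : fox_map) : fox_map :=
  FoxMap (@GamSmash_add_continuous _ _ C _ _ y0 _ _
            (fox_pointed m) (fox_pointed n) (@fox_cts m) (@fox_cts n))
    (GamSmash_add_pointed C (fox_pointed m) (fox_pointed n)).

Definition fox_map_inv (m : fox_map) : fox_map :=
  FoxMap (@GamSmash_rev_continuous _ _ C _ _ y0 _ (fox_pointed m) (@fox_cts m))
    (GamSmash_rev_pointed C (fox_pointed m)).

Definition fox_one : fox := fox_class fox_unit.
Definition fox_mul (x y : fox) : fox :=
  fox_class (fox_map_mul (repr x) (repr y)).
Definition fox_inv (x : fox) : fox := fox_class (fox_map_inv (repr x)).

Let mul_quot m n :
  fox_fun (fox_map_mul m n) \o @GamW_quot Gam W =
  GamW_add C (fox_quot m) (fox_quot n).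
Proof. exact: GamSmash_add_quot (fox_pointed m) (fox_pointed n). Qed.

Let inv_quot m :
  fox_fun (fox_map_inv m) \o @GamW_quot Gam W = GamW_rev C (fox_quot m).
Proof. exact: GamSmash_rev_quot (fox_pointed m). Qed.

Lemma fox_mulE m n :
  fox_mul (fox_class m) (fox_class n) = fox_class (fox_map_mul m n).
Proof.
have /fox_class_quotP hm := fox_repr (fox_class m).
have /fox_class_quotP hn := fox_repr (fox_class n).
apply/fox_class_quotP; rewrite !mul_quot; exact: (GamW_add_homotopic C hm hn).
Qed.

Lemma fox_invE m : fox_inv (fox_class m) = fox_class (fox_map_inv m).
Proof.
have /fox_class_quotP hm := fox_repr (fox_class m).
apply/fox_class_quotP; rewrite !inv_quot; exact: (GamW_rev_homotopic C hm).
Qed.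

Let mulA : associative fox_mul.
Proof.
move=> x y z; rewrite -(fox_repr x) -(fox_repr y) -(fox_repr z).
rewrite !fox_mulE; apply/fox_class_quotP; rewrite !mul_quot /fox_quot !mul_quot.
exact: (GamW_addA C (fox_quot_triple _) (fox_quot_triple _)
  (fox_quot_triple _) (@fox_quot_cts _) (@fox_quot_cts _) (@fox_quot_cts _)).
Qed.

Let mul1 : left_id fox_one fox_mul.
Proof.
move=> x; rewrite -(fox_repr x) /fox_one fox_mulE.
by apply/fox_class_quotP; rewrite mul_quot;
  exact: (GamW_add0 C (fox_quot_triple _) (@fox_quot_cts _)).
Qed.

Let mulr1 : right_id fox_one fox_mul.
Proof.
move=> x; rewrite -(fox_repr x) /fox_one fox_mulE.
by apply/fox_class_quotP; rewrite mul_quot;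
  exact: (GamW_addr0 C (fox_quot_triple _) (@fox_quot_cts _)).
Qed.

Let mulV : left_inverse fox_one fox_inv fox_mul.
Proof.
move=> x; rewrite -(fox_repr x) /fox_one fox_invE fox_mulE.
apply/fox_class_quotP; rewrite mul_quot /fox_quot inv_quot.
exact: (GamW_addNr C (fox_quot_triple _) (@fox_quot_cts _)).
Qed.

Let mulrV : right_inverse fox_one fox_inv fox_mul.
Proof.
move=> x; rewrite -(fox_repr x) /fox_one fox_invE fox_mulE.
apply/fox_class_quotP; rewrite mul_quot /fox_quot inv_quot.
exact: (GamW_addrN C (fox_quot_triple _) (@fox_quot_cts _)).
Qed.

HB.instance Definition _ := isGroup.Build fox mulA mul1 mulr1 mulV mulrV.

End fox_def.
Arguments fox_map Gam W {Y} y0.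

Section fox_inclusion.
Context {R : realType} {Gam : bpTopologicalType} (C : cogrouplike Gam R).
Context (W : topologicalType).
Context {G : groupType} {Y : topologicalType} (a : continuous_action G Y).
Context (y0 : Y).

Let incl_continuous (m : fox_map Gam W y0) :
  continuous (fox_fun m \o @GamW_quot Gam W).
Proof. exact: (cts_comp GamW_quot_continuous (@fox_cts _ _ _ _ m)). Qed.

Let incl_triple (m : fox_map Gam W y0) :
  triple_map y0 (a 1%g y0) (fox_fun m \o @GamW_quot Gam W).
Proof. by rewrite gact1; exact: (pointed_triple (fox_pointed m)). Qed.

Definition fox_incl_map (m : fox_map Gam W y0) : rhodes_map Gam W a y0 :=
  RhodesMap (@incl_continuous m) (incl_triple m).

Definition fox_incl (x : fox C W y0) : rhodes C W a y0 :=
  rhodes_class C (fox_incl_map (repr x)).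

Lemma fox_inclE m : fox_incl (fox_class C m) = rhodes_class C (fox_incl_map m).
Proof.
have /fox_class_quotP h := fox_repr (fox_class C m).
by apply/rhodes_classP; split=> //=; rewrite gact1.
Qed.

End fox_inclusion.
Arguments fox_incl {R Gam C W G Y} a {y0} x.

Section induced_maps.
Context {R : realType} {Gam : bpTopologicalType} (C : cogrouplike Gam R).
Context (W : topologicalType) {G : groupType} {Y Z : topologicalType}.
Context {aY : continuous_action G Y} {aZ : continuous_action G Z}.
Context {y0 : Y} {z0 : Z} {k : Y -> Z}.
Hypotheses (kc : continuous k) (kG : forall g y, k (aY g y) = aZ g (k y)).
Hypothesis (k0 : k y0 = z0).

Let rhodes_push_continuous (m : rhodes_map Gam W aY y0) :
  continuous (k \o rhodes_fun m).
Proof. exact: (cts_comp (@rhodes_cts _ _ _ _ _ _ m) kc). Qed.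

Let rhodes_push_triple (m : rhodes_map Gam W aY y0) :
  triple_map z0 (aZ (rhodes_elt m) z0) (k \o rhodes_fun m).
Proof. by rewrite -k0 -kG; exact/triple_comp/rhodes_triple. Qed.

Definition rhodes_map_push (m : rhodes_map Gam W aY y0) : rhodes_map Gam W aZ z0 :=
  RhodesMap (@rhodes_push_continuous m) (rhodes_push_triple m).

Definition rhodes_push (x : rhodes C W aY y0) : rhodes C W aZ z0 :=
  rhodes_class C (rhodes_map_push (repr x)).

Lemma rhodes_pushE m :
  rhodes_push (rhodes_class C m) = rhodes_class C (rhodes_map_push m).
Proof.
have /rhodes_classP[em hm] := rhodes_repr (rhodes_class C m).
apply/rhodes_classP; split=> //=.
by rewrite -k0 -kG; exact: triple_comp_homotopic.
Qed.

Let fox_push_continuous (m : fox_map Gam W y0) : continuous (k \o fox_fun m).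
Proof. exact: (cts_comp (@fox_cts _ _ _ _ m) kc). Qed.

Let fox_push_pointed (m : fox_map Gam W y0) : pointed_map z0 (k \o fox_fun m).
Proof. by rewrite /pointed_map /= (fox_pointed m). Qed.

Definition fox_map_push (m : fox_map Gam W y0) : fox_map Gam W z0 :=
  FoxMap (@fox_push_continuous m) (fox_push_pointed m).

Definition fox_push (x : fox C W y0) : fox C W z0 :=
  fox_class C (fox_map_push (repr x)).

Lemma fox_pushE m : fox_push (fox_class C m) = fox_class C (fox_map_push m).
Proof.
have /fox_classP h := fox_repr (fox_class C m).
move: h => /homotopic_throughP[H [cH H0 H1 HP]].
apply/fox_classP/homotopic_throughP.
exists (fun p => k (H p)); split=> [|z t t0|z t t1|t].
- exact: (cts_comp cH kc).
- by rewrite H0.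
- by rewrite H1.
- by rewrite /pointed_map HP.
Qed.

End induced_maps.

(* X^X with the compact-open topology. *)
Definition selfmap (X : topologicalType) : Type := continuousType X X.

HB.instance Definition _ (X : topologicalType) := Choice.on (selfmap X).
HB.instance Definition _ (X : topologicalType) :=
  Topological.copy (selfmap X)
    (initial_topology (fun f : continuousType X X => (f : {compact-open, X -> X}))).

Section selfmap.
Context {G : groupType} {X : topologicalType} (a : continuous_action G X).

Definition selfmap_id : selfmap X := idfun.

Let act_comp_continuous (g : G) (f : selfmap X) :
  continuous (a g \o (f : continuousType X X)).
Proof. exact: (cts_comp (@cts_fun _ _ (f : continuousType X X)) (@gact_cts _ _ a g)). Qed.

Definition selfmap_act (g : G) (f : selfmap X) : selfmap X :=
  mkcts (@act_comp_continuous g f).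

Let selfmap_act1 f : selfmap_act 1%g f = f.
Proof. by apply/continuousEP => x; exact: gact1. Qed.

Let selfmap_actM g h f :
  selfmap_act (g * h)%g f = selfmap_act g (selfmap_act h f).
Proof. by apply/continuousEP => x; exact: gactM. Qed.

Let selfmap_open (K O : set X) : compact K -> open O ->
  open [set f : selfmap X | (f : continuousType X X) @` K `<=` O].
Proof.
move=> cK oO; exists ([set f : {compact-open, X -> X} | f @` K `<=` O]) => //.
exact: compact_open_open.
Qed.

Let selfmap_act_continuous g : continuous (selfmap_act g).
Proof.
apply: continuous_comp_initial => f.
apply/compact_open_cvgP; first by apply: fmap_filter; exact: nbhs_filter.
move=> K O cK oO fKO.
apply: (filterS _ (open_nbhs_nbhs (conj
  (selfmap_open cK (open_comp (fun x _ => @gact_cts _ _ a g x) oO)) _))).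
  by move=> h hK _ [x Kx <-]; apply: hK; exists x.
by move=> _ [x Kx <-]; apply: fKO; exists x.
Qed.

Definition selfmap_action : continuous_action G (selfmap X) :=
  ContinuousAction selfmap_act1 selfmap_actM selfmap_act_continuous.

Context (x0 : X).

Definition ev (f : selfmap X) : X := (f : continuousType X X) x0.

Lemma ev_continuous : continuous ev.
Proof.
apply/continuousP => O oO.
rewrite (_ : _ @^-1` _ =
    [set f : selfmap X | (f : continuousType X X) @` [set x0] `<=` O]).
  exact: selfmap_open (@compact_set1 _ x0) oO.
by apply/seteqP; split=> f /= h; [move=> _ [_ -> <-]|apply: h; exists x0].
Qed.

Lemma ev_equivariant g f : ev (selfmap_action g f) = a g (ev f).
Proof. by []. Qed.

Lemma ev_id : ev selfmap_id = x0.
Proof. by []. Qed.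

Context {R : realType} {Gam : bpTopologicalType} (C : cogrouplike Gam R).
Context (W : topologicalType).

Definition rhodes_ev :
    rhodes C W selfmap_action selfmap_id -> rhodes C W a x0 :=
  rhodes_push ev_continuous ev_equivariant ev_id.

Definition fox_ev : fox C W selfmap_id -> fox C W x0 :=
  fox_push ev_continuous ev_id.

Definition Gsigma : set (rhodes C W a x0) := range rhodes_ev.

Definition Gtau : set (fox C W x0) := range fox_ev.

(* G_0 *)
Definition homotopic_to_id : set G :=
  [set g | homotopic_through R (fun _ => True) (a g) (@id X)].

End selfmap.
Arguments Gsigma {G X} a x0 {R Gam} C W.
Arguments Gtau {X} x0 {R Gam} C W.
Arguments homotopic_to_id {G X} a R.

Definition subgroup (H : groupType) (S : set H) : Prop :=
  [/\ S 1%g, forall x y, S x -> S y -> S (x * y)%g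
    & forall x, S x -> S (x^-1)%g].

(* Exactness of 1 -> K -> H -> N -> 1, where K, H, N are subgroups of the groups
   on which [i] and [p] are defined. *)
Record short_exact (A B D : groupType) (K : set A) (H : set B) (N : set D)
    (i : A -> B) (p : B -> D) : Prop := ShortExact {
  ses_subK : subgroup K;
  ses_subH : subgroup H;
  ses_subN : subgroup N;
  ses_iM : forall x y, K x -> K y -> i (x * y)%g = (i x * i y)%g;
  ses_pM : forall x y, H x -> H y -> p (x * y)%g = (p x * p y)%g;
  ses_iH : forall x, K x -> H (i x);
  ses_pN : forall x, H x -> N (p x);
  ses_exactK : forall x, K x -> i x = 1%g -> x = 1%g;
  ses_exactH : forall y, H y -> (p y = 1%g <-> exists2 x, K x & i x = y);
  ses_exactN : forall z, N z -> exists2 y, H y & p y = z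
}.

(* Main.v *)
Require Import Defs.
From HB Require Import structures.
From mathcomp Require Import all_boot all_order all_algebra.
From mathcomp Require Import all_classical all_reals.
From mathcomp Require Import topology normedtype sequences lra.

Set Implicit Arguments.
Unset Strict Implicit.
Unset Printing Implicit Defensive.

Import Order.TTheory GRing.Theory Num.Theory.
Import numFieldNormedType.Exports.

Local Open Scope classical_set_scope.
Local Open Scope ring_scope.

(* A class [F; g] over X^X restricts along a path in Gamma from gamma_1 to
   gamma_2 to a path in X^X from id to g; as X is compactly generated Hausdorff,
   that path is a homotopy from id to g, so g lies in G_0.  If g = 1, then F
   factors through the quotient Gamma(W) -> Gamma_0 /\ (W + point), whence
   exactness in the middle.

   Surjectivity onto G_0 needs a map u : Gamma -> [0, 1] with u(gamma_1) = 0 and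
   u(gamma_2) = 1: a homotopy H from id to g then gives F(w, gamma) =
   H(-, u(gamma)).  No separation axiom on Gamma is available, but the
   comultiplication provides u: as for t |-> (2t, 0), (1, 2t - 1) on the unit
   interval, the wing of D in which nu(gamma) lies is a binary digit, and
   u(gamma) is the number whose digits come from iterating nu.  It is
   characterized by u = (u o proj_1 o nu + u o proj_2 o nu) / 2. *)


(** * A continuous function on Gamma with value 0 at gamma_1 and 1 at gamma_2 *)

Section separating_function.
Context {R : realType} {Gam : bpTopologicalType} (C : cogrouplike Gam R).

Let phi1 (g : Gam) : Gam := (conu C g).1.
Let phi2 (g : Gam) : Gam := (conu C g).2.

Let phi1_continuous : continuous phi1.
Proof. exact: cts_o (@cts_fst _ _) (conu_cts C). Qed.

Let phi2_continuous : continuous phi2.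
Proof. exact: cts_o (@cts_snd _ _) (conu_cts C). Qed.

(** The iteration starts from the indicator of [one], which lies below its own average because nu
    fixes [one]; hence the approximations increase with [n]. They need not be continuous. *)
Fixpoint binary_approx n (g : Gam) : R :=
  if n is n'.+1
  then (binary_approx n' (conu C g).1 + binary_approx n' (conu C g).2) / 2
  else (g == one)%:R.

Lemma binary_approx_itv n g : 0 <= binary_approx n g <= 1.
Proof.
elim: n g => [|n IH] g /=; first by case: (g == one); rewrite ?lexx ler01.
by have := IH (phi1 g); have := IH (phi2 g); rewrite /phi1 /phi2; lra.
Qed.

Lemma binary_approx_zero n : binary_approx n zero = 0.
Proof.
elim: n => [|n IH] /=; first by rewrite eq_sym one_neq_zero.
by rewrite conu_zero IH; lra.
Qed.

Lemma binary_approx_one n : binary_approx n one = 1.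
Proof.
elim: n => [|n IH] /=; first by rewrite eqxx.
by rewrite conu_one IH; lra.
Qed.

Lemma binary_approx_nondecreasing g :
  nondecreasing_seq (binary_approx ^~ g).
Proof.
apply/nondecreasing_seqP => n; elim: n g => [|n IH] g.
  rewrite [leLHS]/=; case: eqP => [->|_]; first by rewrite binary_approx_one.
  by have /andP[] := binary_approx_itv 1 g.
by have := IH (phi1 g); have := IH (phi2 g) => /=; rewrite /phi1 /phi2; lra.
Qed.

Definition binary_value (g : Gam) : R := limn (binary_approx ^~ g).

Lemma binary_approx_cvg g : binary_approx ^~ g @ \oo --> binary_value g.
Proof.
apply: nondecreasing_is_cvgn; first exact: binary_approx_nondecreasing.
by exists 1 => _ [n _ <-]; have /andP[] := binary_approx_itv n g.
Qed.

Lemma binary_value_zero : binary_value zero = 0.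
Proof.
rewrite /binary_value (_ : _ ^~ _ = cst 0) ?lim_cst//.
by apply/funext => n; exact: binary_approx_zero.
Qed.

Lemma binary_value_one : binary_value one = 1.
Proof.
rewrite /binary_value (_ : _ ^~ _ = cst 1) ?lim_cst//.
by apply/funext => n; exact: binary_approx_one.
Qed.

Lemma binary_value_itv g : 0 <= binary_value g <= 1.
Proof.
have cv := cvgP _ (binary_approx_cvg (g := g)).
apply/andP; split; [apply: limr_ge|apply: limr_le] => //; near=> n;
  by case/andP: (binary_approx_itv n g).
Unshelve. all: by end_near. Qed.

Lemma binary_valueE g :
  binary_value g = (binary_value (conu C g).1 + binary_value (conu C g).2) / 2.
Proof.
have h : (fun n => binary_approx n.+1 g) @ \oo -->
    (binary_value (conu C g).1 + binary_value (conu C g).2) / 2.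
  by apply: cvgMl; apply: cvgD; exact: binary_approx_cvg.
have h' : (fun n => binary_approx n.+1 g) @ \oo --> binary_value g.
  by rewrite (@cvg_shiftS _ (binary_approx ^~ g)); exact: binary_approx_cvg.
exact: cvg_unique h' h.
Qed.

(** Values in [0, 1] oscillate by at most 1, and each use of [binary_valueE] halves the bound.
    Continuity of the limit follows from this self-similarity rather than from uniform
    convergence. *)
Lemma binary_value_oscillation n g :
  \forall h \near g, `|binary_value h - binary_value g| <= 2^-1 ^+ n.
Proof.
elim: n g => [|n IH] g.
  near=> h; rewrite expr0 ler_norml.
  by have := binary_value_itv h; have := binary_value_itv g; lra.
(* The pieces [phi2 = zero] and [phi1 = one] of Gamma are closed and cover it.
   On each of them one of the two summands of [binary_valueE] is constant, so
   that the factor 1/2 halves the oscillation. *)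
have same_half : \forall h \near g, (phi2 g = zero /\ phi2 h = zero) \/
    (phi1 g = one /\ phi1 h = one).
  have cl2 : closed [set h | phi2 h = zero].
    exact: (closed_preim phi2_continuous (closed_zero C)).
  have cl1 : closed [set h | phi1 h = one].
    exact: (closed_preim phi1_continuous (closed_one C)).
  (* If [g] lies in one piece only, the complement of the other is a neighbourhood of [g]; if it
     lies in both, every [h] shares a piece with it. *)
  have [g2|g2] := pselect (phi2 g = zero); last first.
    have g1 : phi1 g = one by case: (conu_wingsP C g).
    apply: (filterS _ (open_nbhs_nbhs (conj (closed_openC cl2) g2))) => h h2.
    by right; split=> //; case: (conu_wingsP C h).
  have [g1|g1] := pselect (phi1 g = one).
    by apply: filterE => h; case: (conu_wingsP C h); [left|right].
  apply: (filterS _ (open_nbhs_nbhs (conj (closed_openC cl1) g1))) => h h1.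
  by left; split=> //; case: (conu_wingsP C h).
have h1 := phi1_continuous (IH (phi1 g)); have h2 := phi2_continuous (IH (phi2 g)).
near=> h.
have : `|binary_value (phi1 h) - binary_value (phi1 g)| <= 2^-1 ^+ n by near: h.
have : `|binary_value (phi2 h) - binary_value (phi2 g)| <= 2^-1 ^+ n by near: h.
rewrite exprS (binary_valueE h) (binary_valueE g) -!/(phi1 _) -!/(phi2 _).
rewrite !ler_norml.
have : (phi2 g = zero /\ phi2 h = zero) \/ (phi1 g = one /\ phi1 h = one).
  by near: h.
by case=> -[-> ->]; lra.
Unshelve. all: by end_near. Qed.

Lemma binary_value_continuous : continuous binary_value.
Proof.
move=> g; apply/cvgrPdist_le => e e0.
have [n ne] : exists n, (2^-1 : R) ^+ n < e.
  have /cvgrPdist_lt/(_ e e0)[n _ /(_ n (leqnn n))] :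
      (fun n => (2^-1 : R) ^+ n) @ \oo --> (0 : R).
    by apply: cvg_expr; rewrite ger0_norm ?invr_ge0// invf_lt1 ?ltr1n.
  by rewrite sub0r normrN ger0_norm ?exprn_ge0 ?invr_ge0// => ?; exists n.
near=> h; rewrite distrC; apply: le_trans (ltW ne); near: h.
exact: binary_value_oscillation.
Unshelve. all: by end_near. Qed.

End separating_function.


(** * Compactly generated spaces and the exponential law *)

Lemma compactly_generated_continuous (X Y : topologicalType) (f : X -> Y) :
  hausdorff_space X -> compactly_generated X ->
  (forall K : set X, compact K -> {within K, continuous f}) -> continuous f.
Proof.
move=> hX cgX cf; apply/continuous_closedP => D cD; apply: cgX => K cK.
have clK := compact_closed hX cK.
by rewrite closed_setIS//; have /continuous_closedP := cf K cK; exact.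
Qed.

(** The type [subspace K] keeps all points of [X] and isolates those outside [K], so adding [x] to
    [K] gives a compact neighbourhood of [x] in either case. *)
Lemma subspace_compact_locally_compact (X : topologicalType) (K : set X) :
  hausdorff_space X -> compact K -> locally_compact [set: subspace K].
Proof.
move=> hX cK x _; rewrite withinET.
have hK := subspace_hausdorff (A := K) hX.
have cKK : compact (K : set (subspace K)).
  by have := (compact_subspaceIP K K).2; rewrite !setIid; exact.
have cKx : compact (K `|` [set x] : set (subspace K)).
  by apply: compactU => //; exact: compact_set1.
exists (K `|` [set x]); last by split=> //; exact: compact_closed.
case: (nbhs_subspaceP K x) => _; last by move=> _ ->; right.
by apply: (@filterE X (nbhs (x : X))) => y Ky; left.
Qed.

Section exponential_law.
Import ArrowAsCompactOpen.
Context {T X Y : topologicalType}.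

(** Local compactness is used twice. That of each compact [K] in [X] uncurries [q] over [K];
    swapping the variables and currying makes x |-> (t |-> q t x) continuous on [K], hence on [X].
    That of [T] then uncurries this map. *)
Lemma compactly_generated_uncurry (q : T -> X -> Y) :
  locally_compact [set: T] -> hausdorff_space T ->
  hausdorff_space X -> compactly_generated X ->
  continuous q -> (forall t, continuous (q t)) ->
  continuous (fun p : X * T => q p.2 p.1).
Proof.
move=> lT hT hX cgX cq cqt.
rewrite (_ : (fun _ => _) = uncurry (fun x t => q t x)); last first.
  by apply/funext => -[].
apply: continuous_uncurry => //; last first.
  move=> x; apply/continuousP => O oO.
  rewrite (_ : _ @^-1` O = q @^-1` [set h | h @` [set x] `<=` O]).
    apply: open_comp => [t _|]; first exact: cq.
    by apply: compact_open_open => //; exact: compact_set1.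
  by apply/seteqP; split=> t /= h; [move=> _ [_ -> <-]|apply: h; exists x].
apply: (compactly_generated_continuous hX cgX) => K cK.
pose qK : T -> subspace K -> Y := q.
have cqK : continuous qK.
  (* A compact set of [subspace K] is compact in [X], so restriction to [K] respects the
     compact-open topologies. *)
  move=> t; apply/compact_open_cvgP => L O /= cL oO LO.
  apply: cq; apply: open_nbhs_nbhs; split=> //.
  apply: compact_open_open => //.
  rewrite -[L]image_id; apply: (continuous_compact (f := @incl_subspace X K)) => //.
  by apply: continuous_subspaceT; exact: incl_subspace_continuous.
have cqu : continuous (uncurry qK).
  apply: continuous_uncurry => //.
  - exact: subspace_compact_locally_compact.
  - exact: subspace_hausdorff.
  - by move=> t; apply: continuous_subspaceT; exact: cqt.
apply: (continuous_curry_fun (f := fun p : subspace K * T => qK p.2 p.1)).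
apply: (cts_o cqu (f := fun p : subspace K * T => (p.2, p.1))).
by apply: cts_pair; [exact: cts_snd|exact: cts_fst].
Qed.

End exponential_law.

(** * Auxiliary facts on paths, homotopies and group morphisms *)

(** A path is a homotopy between constant maps, so the clamping in [homotopic_throughP] extends it
    to all of [R]. *)
Lemma path_joined_extend (R : realType) (X : topologicalType) (x y : X) :
  path_joined R x y -> exists p : R -> X,
    [/\ continuous p, forall t, t <= 0 -> p t = x & forall t, 1 <= t -> p t = y].
Proof.
move=> [p [cp p0 p1]].
have /homotopic_throughP[H [cH H0 H1 _]] :
    homotopic_through R (fun _ => True) (fun _ : X => x) (fun _ => y).
  exists (p \o snd); split=> //.
  apply/continuousP => U oU; have [V oV VE] :=
    (open_subspaceP _ _).1 ((continuousP _).1 cp U oU).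
  apply/open_subspaceP; exists (snd @^-1` V).
    by apply: open_comp => // z _; exact: cts_snd.
  apply/seteqP; split=> z /= -[zV [_ z01]]; split=> //.
    by have : (V `&` `[0, 1]) z.2 by []; rewrite VE => -[].
  by have : (p @^-1` U `&` `[0, 1]) z.2 by []; rewrite -VE => -[].
exists (fun t => H (x, t)); split=> [|t|t]; [|exact: H0|exact: H1].
by apply: (cts_o cH); apply: cts_pair; [exact: cst_continuous|move=> t; exact: cvg_id].
Qed.

Lemma homotopic_through_precomp (R : realType) (A A' B : topologicalType)
    (f g : A -> B) (k : A' -> A) :
  continuous k -> homotopic_through R (fun _ => True) f g ->
  homotopic_through R (fun _ => True) (f \o k) (g \o k).
Proof.
move=> ck /homotopic_throughP[H [cH H0 H1 _]]; apply/homotopic_throughP.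
exists (fun p => H (k p.1, p.2)); split=> // [|x t|x t]; [|exact: H0|exact: H1].
by apply: (cts_o cH); apply: cts_pair; [exact: (cts_o ck (@cts_fst _ _))|exact: cts_snd].
Qed.

Section group_morphism.
Context {H K : groupType} {f : H -> K}.
Hypothesis fM : forall x y, f (x * y)%g = (f x * f y)%g.

Lemma morphism_one : f 1%g = 1%g.
Proof. by apply: (mulgI (f 1%g)); rewrite -fM !mulg1. Qed.

Lemma morphism_inv x : f x^-1%g = (f x)^-1%g.
Proof. by apply: (mulgI (f x)); rewrite -fM !mulgV morphism_one. Qed.

Lemma range_subgroup : subgroup (range f).
Proof.
split; first by exists 1%g => //; exact: morphism_one.
  by move=> _ _ [x _ <-] [y _ <-]; exists (x * y)%g.
by move=> _ [x _ <-]; exists x^-1%g => //; exact: morphism_inv.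
Qed.

End group_morphism.

(** * Rhodes classes, Fox classes and the canonical inclusion *)

Lemma GamW_add_comp (R : realType) (Gam : bpTopologicalType)
    (C : cogrouplike Gam R) (W : topologicalType) (Y Z : Type) (k : Y -> Z)
    (f1 f2 : GamW Gam W -> Y) :
  k \o GamW_add C f1 f2 = GamW_add C (k \o f1) (k \o f2).
Proof.
apply/funext => z; rewrite /GamW_add /=; case: (repr z) => w g.
by rewrite /on_wings; case: ifP.
Qed.

Section classes.
Context {R : realType} {Gam : bpTopologicalType} (C : cogrouplike Gam R).
Context {W : topologicalType} {G : groupType} {Y : topologicalType}.
Context {aY : continuous_action G Y} {y0 : Y}.

Lemma rhodes_class_eqfun (m n : rhodes_map Gam W aY y0) :
  rhodes_elt m = rhodes_elt n -> rhodes_fun m = rhodes_fun n ->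
  rhodes_class C m = rhodes_class C n.
Proof.
move=> e f; apply/rhodes_classP; split=> //; apply: homotopic_refl.
- exact: rhodes_cts.
- exact: rhodes_triple.
- by move=> z; rewrite f.
Qed.

Lemma rhodes_classM (m n : rhodes_map Gam W aY y0) :
  (rhodes_class C m * rhodes_class C n)%g = rhodes_class C (rhodes_map_mul C m n).
Proof. exact: rhodes_mulE. Qed.

Lemma fox_classM (m n : fox_map Gam W y0) :
  (fox_class C m * fox_class C n)%g = fox_class C (fox_map_mul C m n).
Proof. exact: fox_mulE. Qed.

Lemma rhodes_projM (x y : rhodes C W aY y0) :
  rhodes_proj (x * y)%g = (rhodes_proj x * rhodes_proj y)%g.
Proof.
by rewrite -(rhodes_repr x) -(rhodes_repr y) rhodes_classM !rhodes_projE.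
Qed.

Lemma fox_inclM (x y : fox C W y0) :
  fox_incl aY (x * y)%g = (fox_incl aY x * fox_incl aY y)%g.
Proof.
rewrite -(fox_repr x) -(fox_repr y) fox_classM !fox_inclE rhodes_classM.
apply/rhodes_classP; split; first by rewrite /= mulg1.
apply: homotopic_refl.
- exact: rhodes_cts.
- exact: rhodes_triple.
- move=> z /=; rewrite -[LHS]/((_ \o @GamW_quot _ _) z).
  rewrite (GamSmash_add_quot C (fox_pointed _) (fox_pointed _)).
  by congr (GamW_add C _ _ z); apply/funext => u /=; rewrite gact1.
Qed.

Lemma fox_incl_proj (x : fox C W y0) : rhodes_proj (fox_incl aY x) = 1%g.
Proof. by rewrite -(fox_repr x) fox_inclE rhodes_projE. Qed.

(** A homotopy of triples that keeps both basepoints at [y0] descends to a pointed homotopy on the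
    smash product. *)
Lemma fox_incl_inj : injective (@fox_incl R Gam C W G Y aY y0).
Proof.
move=> x y; rewrite -(fox_repr x) -(fox_repr y) !fox_inclE.
by move=> /rhodes_classP[_] /=; rewrite gact1 => /fox_class_quotP.
Qed.

Lemma GamW_factor (f : GamW Gam W -> Y) : continuous f ->
  triple_map y0 y0 f -> exists m : fox_map Gam W y0, fox_fun m \o @GamW_quot Gam W = f.
Proof.
move=> cf [f0 f1].
(* The disjoint basepoint [None] must go to [y0], the common value of [f] at both basepoints of
   Gamma(W). *)
pose F (p : Gam * adjoin_point W) : Y :=
  if p.2 is Some w then f (to_GamW (w, p.1)) else y0.
pose K (z : GamSmash Gam W) : Y := F (repr (repr z).1, (repr z).2).
have KE g v : K (to_GamSmash (to_Gam0 g, v)) = F (g, v).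
  by apply: (@repr_to_GamSmash _ _ _ F y0) => // -[w|//]; rewrite /F /= ?f0 ?f1.
have K0 : pointed_map y0 K by rewrite /pointed_map KE.
have KQ : K \o @GamW_quot Gam W = f.
  by apply/funext; apply: GamW_ind => w g; rewrite /= GamW_quotE KE.
have cK : continuous K by apply: (GamSmash_continuous C K0); rewrite KQ.
by exists (FoxMap cK K0).
Qed.

Lemma rhodes_proj_eq1 (x : rhodes C W aY y0) :
  rhodes_proj x = 1%g -> exists y, fox_incl aY y = x.
Proof.
rewrite -(rhodes_repr x) rhodes_projE; move: (repr x) => m m1.
have t : triple_map y0 y0 (rhodes_fun m).
  by have := rhodes_triple m; rewrite m1 gact1.
have [n nE] := GamW_factor (@rhodes_cts _ _ _ _ _ _ m) t.
by exists (fox_class C n); rewrite fox_inclE; apply: rhodes_class_eqfun.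
Qed.

End classes.

(** * Homomorphisms induced by equivariant pointed maps *)

Section induced_morphisms.
Context {R : realType} {Gam : bpTopologicalType} (C : cogrouplike Gam R).
Context {W : topologicalType} {G : groupType} {Y Z : topologicalType}.
Context {aY : continuous_action G Y} {aZ : continuous_action G Z}.
Context {y0 : Y} {z0 : Z} {k : Y -> Z}.
Hypotheses (kc : continuous k) (kG : forall g y, k (aY g y) = aZ g (k y)).
Hypothesis (k0 : k y0 = z0).

Lemma rhodes_push_proj (x : rhodes C W aY y0) :
  rhodes_proj (rhodes_push kc kG k0 x) = rhodes_proj x.
Proof. by rewrite -(rhodes_repr x) rhodes_pushE !rhodes_projE. Qed.

Lemma rhodes_pushM (x y : rhodes C W aY y0) :
  rhodes_push kc kG k0 (x * y)%g =
  (rhodes_push kc kG k0 x * rhodes_push kc kG k0 y)%g.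
Proof.
rewrite -(rhodes_repr x) -(rhodes_repr y) rhodes_classM !rhodes_pushE.
rewrite rhodes_classM; apply/rhodes_classP; split=> //.
apply: homotopic_refl.
- exact: rhodes_cts.
- exact: rhodes_triple.
- move=> z /=; rewrite -[LHS]/((k \o _) z) GamW_add_comp.
  congr (GamW_add C _ _ z); apply/funext => u /=; exact: kG.
Qed.

Lemma fox_pushM (x y : fox C W y0) :
  fox_push kc k0 (x * y)%g = (fox_push kc k0 x * fox_push kc k0 y)%g.
Proof.
rewrite -(fox_repr x) -(fox_repr y) fox_classM !fox_pushE fox_classM.
apply/fox_class_quotP; apply: homotopic_refl.
- exact: (cts_o (@fox_cts _ _ _ _ _) GamW_quot_continuous).
- exact: (pointed_triple (fox_pointed _)).
- move=> z; rewrite /= -[LHS]/((k \o _ \o @GamW_quot _ _) z).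
  rewrite -[RHS]/((_ \o @GamW_quot _ _) z) -compA.
  rewrite (GamSmash_add_quot C (fox_pointed _) (fox_pointed _)) GamW_add_comp.
  by rewrite (GamSmash_add_quot C (fox_pointed (fox_map_push kc k0 _))
     (fox_pointed (fox_map_push kc k0 _))).
Qed.

(** Both sides are represented by the same composite, with group element 1. Applied to [ev], this
    naturality carries the inclusion over X^X to the evaluation subgroups. *)
Lemma fox_incl_push (x : fox C W y0) :
  fox_incl aZ (fox_push kc k0 x) = rhodes_push kc kG k0 (fox_incl aY x).
Proof.
rewrite -(fox_repr x) fox_pushE !fox_inclE rhodes_pushE.
apply/rhodes_classP; split=> //; apply: homotopic_refl => //.
  exact: rhodes_cts.
exact: rhodes_triple.
Qed.

End induced_morphisms.

(** * The group G_0 and paths in X^X *)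

Section evaluation.
Context {R : realType} {G : groupType} {X : topologicalType}.
Context (a : continuous_action G X).

(** Precomposing a homotopy from [g] to the identity with [h] joins [gh] to [h]; with the inverse of
    [g], it joins the identity to that inverse. *)
Lemma homotopic_to_id_subgroup : subgroup (homotopic_to_id a R).
Proof.
split=> [|g h Hg Hh|g Hg].
- by apply: homotopic_refl => // [|x]; [exact: gact_cts|exact: gact1].
- apply: (homotopic_trans _ Hh).
  rewrite (_ : gact a (g * h)%g = a g \o a h).
    exact: (homotopic_through_precomp (@gact_cts _ _ a h) Hg).
  by apply/funext => x; exact: gactM.
- apply: homotopic_sym.
  have := homotopic_through_precomp (@gact_cts _ _ a g^-1%g) Hg.
  rewrite (_ : a g \o _ = id)//; apply/funext => x /=.
  by rewrite -gactM mulgV gact1.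
Qed.

Lemma selfmap_continuousP (Z : topologicalType) (f : Z -> selfmap X) :
  continuous f <->
  continuous (fun z => (f z : continuousType X X) : {compact-open, X -> X}).
Proof.
split=> cf; last exact: continuous_comp_initial.
apply: (cts_o _ cf (g := fun h : selfmap X =>
  (h : continuousType X X) : {compact-open, X -> X})).
exact: initial_continuous.
Qed.

Lemma selfmap_path_homotopic (q : R -> selfmap X) (f g : selfmap X) :
  hausdorff_space X -> compactly_generated X -> continuous q ->
  (forall t, t <= 0 -> q t = f) -> (forall t, 1 <= t -> q t = g) ->
  homotopic_through R (fun _ => True)
    (f : continuousType X X) (g : continuousType X X).
Proof.
move=> hX cgX cq q0 q1; apply/homotopic_throughP.
exists (fun p => (q p.2 : continuousType X X) p.1).
split=> // [|x t t0|x t t1]; last 2 first.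
- by rewrite /= q0.
- by rewrite /= q1.
apply: (compactly_generated_uncurry
  (q := fun t => (q t : continuousType X X) : X -> X)) => //.
- exact: locally_compactR.
- exact/selfmap_continuousP.
- by move=> t; exact: cts_fun.
Qed.

Context {Gam : bpTopologicalType} (C : cogrouplike Gam R) (W : topologicalType).

(** A point of [W] and a path in [Gam] together give a path in Gamma(W) between its two basepoints,
    along which the representative is restricted. *)
Lemma rhodes_selfmap_elt (m : rhodes_map Gam W (selfmap_action a) (@selfmap_id X)) :
  hausdorff_space X -> compactly_generated X -> [set: W] !=set0 ->
  path_joined R (zero : Gam) one -> homotopic_to_id a R (rhodes_elt m).
Proof.
move=> hX cgX [w _] /path_joined_extend[p [cp p0 p1]].
have [mz mo] := rhodes_triple m.
apply: homotopic_sym.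
apply: (selfmap_path_homotopic (q := fun t => rhodes_fun m (to_GamW (w, p t)))
  (f := @selfmap_id X) (g := selfmap_action a (rhodes_elt m) (@selfmap_id X)) hX cgX) => //.
- apply: (cts_o (@rhodes_cts _ _ _ _ _ _ m)); apply: (cts_o to_GamW_continuous).
  by apply: cts_pair => //; exact: cst_continuous.
- by move=> t t0; rewrite p0.
- by move=> t t1; rewrite p1.
Qed.

Lemma homotopic_to_id_rhodes g : homotopic_to_id a R g ->
  exists m : rhodes_map Gam W (selfmap_action a) (@selfmap_id X), rhodes_elt m = g.
Proof.
move=> /homotopic_sym/homotopic_throughP[H [cH H0 H1 _]].
have cHt t : continuous (fun x => H (x, t)).
  by apply: (cts_o cH); apply: cts_pair; [move=> x; exact: cvg_id|exact: cst_continuous].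
pose q t : selfmap X := mkcts (cHt t).
have cq : continuous q.
  apply/selfmap_continuousP.
  apply: (continuous_curry_fun (f := fun p : R * X => H (p.2, p.1))).
  by apply: (cts_o cH); apply: cts_pair; [exact: cts_snd|exact: cts_fst].
have q0 : q 0 = @selfmap_id X by apply/continuousEP => x; exact: H0.
have q1 : q 1 = selfmap_action a g (@selfmap_id X).
  by apply/continuousEP => x; exact: H1.
(* All representatives of a class share their coordinate in [Gam], so [F] does not depend on the
   choice made by [repr]. *)
pose F (z : GamW Gam W) := q (binary_value C (repr z).2).
have FE p : F (to_GamW p) = q (binary_value C p.2).
  rewrite /F; apply: (@repr_to_GamW _ _ _ (fun p => q (binary_value C p.2)) (q 0) (q 1)).
    by move=> w; rewrite /= binary_value_zero.
  by move=> w; rewrite /= binary_value_one.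
have cF : continuous F.
  apply: GamW_continuous; rewrite (_ : _ \o _ = fun p => q (binary_value C p.2)).
    apply: (cts_o cq); apply: (cts_o (@binary_value_continuous _ _ C)).
    exact: cts_snd.
  by apply/funext => p; exact: FE.
have tF : triple_map (@selfmap_id X) (selfmap_action a g (@selfmap_id X)) F.
  by split=> w; rewrite FE/= ?binary_value_zero ?binary_value_one.
by exists (RhodesMap cF tF).
Qed.

End evaluation.

Theorem theorem3p1 (R : realType) (G : groupType) (X : topologicalType)
    (a : continuous_action G X) (x0 : X) (W : topologicalType)
    (Gam : bpTopologicalType) (C : cogrouplike Gam R) :
  hausdorff_space X -> compactly_generated X ->
  (forall x y : X, path_joined R x y) ->
  [set: W] !=set0 ->
  path_joined R (zero : Gam) (one : Gam) ->
  short_exact (Gtau x0 C W) (Gsigma a x0 C W) (homotopic_to_id a R)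
    (fox_incl a) rhodes_proj.
Proof.
move=> hX cgX _ W0 pGam; split.
- exact: range_subgroup (fox_pushM _ _).
- exact: range_subgroup (rhodes_pushM _ _ _).
- exact: homotopic_to_id_subgroup.
- by move=> x y _ _; exact: fox_inclM.
- by move=> x y _ _; exact: rhodes_projM.
- move=> _ [x _ <-]; exists (fox_incl (selfmap_action a) x) => //.
  by rewrite /rhodes_ev -fox_incl_push.
- move=> _ [x _ <-]; rewrite rhodes_push_proj -(rhodes_repr x) rhodes_projE.
  exact: rhodes_selfmap_elt.
- by move=> x _ x1; apply: (@fox_incl_inj _ _ C _ _ _ a);
    rewrite x1 (morphism_one (fox_inclM (C := C) (aY := a))).
- move=> _ [x _ <-]; rewrite rhodes_push_proj; split.
    (* Evaluation keeps the group element, so the factorization takes place already over X^X; this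
       puts the resulting Fox class in [Gtau]. *)
    move=> /rhodes_proj_eq1[y <-]; exists (fox_ev x0 y); first by exists y.
    by rewrite /rhodes_ev -fox_incl_push.
  by move=> [y _ yE]; rewrite -(fox_incl_proj (aY := a) y) yE rhodes_push_proj.
- move=> g /(homotopic_to_id_rhodes C W)[m mg].
  exists (rhodes_ev x0 (rhodes_class C m)); first by exists (rhodes_class C m).
  by rewrite rhodes_push_proj rhodes_projE.
Qed.
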